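(* Let $(W,S)$ be a finite Coxeter system of rank $\ell=|S|$, with Poincaré polynomial $P(q)=\sum_{w\in W}q^{\ell(w)}$, and for $w\in W$ let $g_w(q)=\sum_{\chi\in\operatorname{Irr}(W)}\chi(w)\,d_\chi(q)$, where $d_\chi(q)$ are the generic degrees of $W$. Suppose $w\in W$ is conjugate to an element of a standard parabolic subgroup $W_J$ ($J\subseteq S$) all of whose irreducible components are of type $A$. Then $$g_w(q)=\frac{(1-q)^{\ell}P(q)}{\det(1-qw)},$$ where $\det(1-qw)$ is computed in the natural reflection representation of $W$.
   Context: Let $W$ be a finite Coxeter group with set of distinguished generators $S$, length function $\ell(\cdot)$, identity $e$, and set of irreducible complex characters $\operatorname{Irr}(W)$. Let $K\subseteq\mathbb{C}$ be a splitting field for $W$, $q$ an indeterminate, and $\mathcal{H}$ the Hecke algebra of $W$ over $K(\sqrt q)$ with basis $T_w$ ($w\in W$) and relations $T_s^2=qT_e+(q-1)T_s$ for $s\in S$, and $T_xT_y=T_{xy}$ whenever $\ell(x)+\ell(y)=\ell(xy)$. $\mathcal{H}$ is split semisimple; each irreducible character $\tilde\chi$ of $\mathcal{H}$ satisfies $\tilde\chi(T_w)\in K[\sqrt q]$, and specializing $\sqrt q\mapsto 1$ in $\tilde\chi(T_w)$ gives $\chi(w)$ for a unique $\chi\in\operatorname{Irr}(W)$, giving a bijection $\chi\leftrightarrow\tilde\chi$. The generic degrees $d_\chi(q)$, $\chi\in\operatorname{Irr}(W)$, are the unique elements satisfying $\sum_{\chi\in\operatorname{Irr}(W)}\tilde\chi(T_w)d_\chi(q)=P(q)$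 if $w=e$ and $=0$ if $w\neq e$, where $P(q)=\sum_{w\in W}q^{\ell(w)}$. For $J\subseteq S$, $W_J$ is the subgroup generated by $J$; its components are the parabolic subgroups corresponding to the connected components of the Coxeter graph of $J$, and type $A$ means that component's Coxeter graph is a path with all edge labels $3$ (a symmetric group). *)

(* Defs.v *)
From HB Require Import structures.
From mathcomp Require Import all_boot all_order all_algebra all_fingroup.
From mathcomp Require Import all_solvable all_field all_character fraction.
Set Implicit Arguments. Unset Strict Implicit. Unset Printing Implicit Defensive.
Import Order.TTheory GRing.Theory Num.Theory.
Local Open Scope ring_scope.

Section Coxeter.
Variable gT : finGroupType.
Implicit Types (S J : {set gT}) (w x s t : gT).

(* (gT, S) is a finite Coxeter system: S is a set of involutions generating
   the whole group gT, and gT has the Coxeter presentation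
   < S | (s t)^(m_st) = 1 >, with m_st the order of s t, stated as the
   universal property of the presentation (tested against all finite groups). *)
Definition coxeter_system S : Prop :=
  [/\ (forall s, s \in S -> #[s]%g = 2),
      <<S>>%g = [set: gT] &
      forall (hT : finGroupType) (f : gT -> hT),
        (forall s t, s \in S -> t \in S -> ((f s * f t) ^+ #[(s * t)%g])%g = 1%g) ->
        exists phi : {morphism [set: gT] >-> hT},
          forall s, s \in S -> phi s = f s].

Definition word_of S n w : bool :=
  [exists t : n.-tuple gT, all (mem S) t && ((\prod_(y <- t) y)%g == w)].

Definition clen S w : nat := find (fun n => word_of S n w) (iota 0 #|gT|.+1).

Definition redword S w : seq gT :=
  match [pick t : (clen S w).-tuple gT |
           all (mem S) t && ((\prod_(y <- t) y)%g == w)] with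
  | Some t => val t
  | None => [::]
  end.

Definition poincare (R : nzRingType) S (q : R) : R :=
  \sum_(w : gT) q ^+ clen S w.

(* Geometric (natural reflection) representation on the space with basis
   (alpha_s)_{s in S}, indexed by 'I_#|S| via enum_val;
   B(alpha_s, alpha_t) = - cos(pi / m_st), and cos(pi/m) = Re(m.-root (-1))
   since m.-root (-1) = exp(i pi / m) in algC. *)
Definition cosm (m : nat) : algC := 'Re (m.-root (-1)).
Definition bilin S (i j : 'I_#|S|) : algC :=
  - cosm #[(enum_val i * enum_val j)%g]%g.
(* sigma_s(v) = v - 2 B(alpha_s, v) alpha_s, matrix acting on coordinate columns *)
Definition refl_mx S (s : gT) : 'M[algC]_#|S| :=
  \matrix_(i, j) ((i == j)%:R - (enum_val i == s)%:R * 2 * bilin i j).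
Definition geom_rep S w : 'M[algC]_#|S| :=
  \prod_(y <- redword S w) refl_mx S y.

Definition cox_edge J : rel gT :=
  fun s t => [&& s \in J, t \in J & (3 <= #[(s * t)%g]%g)%N].
Definition cox_component J s : {set gT} := [set t | connect (cox_edge J) s t].
Definition typeA_path (c : seq gT) : bool :=
  uniq c && [forall i : 'I_(size c), forall j : 'I_(size c), (i != j) ==>
     (#[(nth 1%g c i * nth 1%g c j)%g]%g == (
        (if (i.+1 == j) || (j.+1 == i) then 3 else 2))%N)].
Definition all_components_typeA J : Prop :=
  forall s, s \in J -> exists c : seq gT,
      typeA_path c /\ [set x in c] = cox_component J s.

End Coxeter.

(* The field K(sqrt q): rational functions over algC in u = sqrt q. *)
Notation tofracC := (@FracField.tofrac {poly algC}).
Notation Fq := {fraction {poly algC}}.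
Definition cst (c : algC) : Fq := tofracC (c%:P).
Definition uq : Fq := tofracC ('X : {poly algC}).
Definition qq : Fq := uq ^+ 2.

(* A representation of the Hecke algebra H (basis T_w, w in W) of degree n:
   rho w is the image of T_w; the relations are those defining H. *)
Definition hecke_rep (gT : finGroupType) (S : {set gT}) n
    (rho : gT -> 'M[Fq]_n) : Prop :=
  [/\ rho 1%g = 1%:M,
      (forall s, s \in S -> rho s *m rho s = qq *: rho 1%g + (qq - 1) *: rho s) &
      (forall x y, clen S x + clen S y = clen S (x * y)%g ->
                   rho x *m rho y = rho (x * y)%g)].

Definition hecke_irr (gT : finGroupType) n (rho : gT -> 'M[Fq]_n) : Prop :=
  (0 < n)%N /\ forall U : 'M[Fq]_n, (forall w, stablemx U (rho w)) ->
    (U == (0 : 'M[Fq]_n))%MS \/ (U == (1%:M : 'M[Fq]_n))%MS.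

(* Main.v *)
(* Both sides are class functions of w. Call g the left-hand side and set
   F(w) = (1 - q)^l / det(1 - q w), so that the claim is g = P F on W_J.

   For I a subset of S, the element e_I = sum_(w in W_I) T_w satisfies
   e_I^2 = P_I e_I, so in each irreducible representation its trace is P_I times
   the rank r_chi of an idempotent. At q = 1 this gives
   sum_(w in W_I) chi(w) = |W_I| r_chi, while the equations defining the generic
   degrees give sum_chi P_I r_chi d_chi = P. Hence
   sum_(w in W_I) g(w) = |W_I| P / P_I.

   If I has type A then also sum_(w in W_I) F(w) = |W_I| / P_I, a Molien type
   identity. Splitting W_I along the double cosets of a smaller symmetric group
   reduces it to Newton's identity n h_n = sum_k p_k h_(n-k) for
   h_n = 1 / [n]_q! and p_k = (1 - q)^k / (1 - q^k), where p_k is the value of F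
   at a k-cycle.

   So f = g - P F has zero sum over W_I for all subsets I of J. In type A every
   element of W_I is conjugate in W_I to the product, in a fixed order, of the
   elements of a subset of I; by induction on I, f vanishes at all these
   products. *)
Require Import Defs.
From HB Require Import structures.
From mathcomp Require Import all_boot all_order all_algebra all_fingroup.
From mathcomp Require Import all_solvable all_field all_character fraction.
From mathcomp Require Import zify ring.
Set Implicit Arguments. Unset Strict Implicit. Unset Printing Implicit Defensive.
Import Order.TTheory GRing.Theory Num.Theory.

(** * The exchange condition and Matsumoto's theorem *)

Local Open Scope group_scope.

(** The universal property in [coxeter_system] only sees finite groups, whereas [geom_rep] has
    values in matrices over an infinite field and multiplies along one chosen reduced word. So the
    property is applied once, to the finite group of permutations of W x Z/2, and yields the
    exchange condition. Matsumoto's theorem then extends any map from S to a ring that respects the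
    Coxeter relations to a multiplicative map on W, which makes F a class function.

    The fixed order of the products is kept by listing type A subsets as sequences: the paths of the
    Coxeter graph are laid end to end, and a subset becomes a sublist, whose graph is again a union
    of paths.

    Three properties of F carry the Molien type identity: it is a class function, it is
    multiplicative over mutually orthogonal subsets of S, and its value at the product of a path
    with k vertices, a (k+1)-cycle, is p_(k+1). *)

Notation gprod u := (\prod_(y <- u) y)%g.

Section Words.
Variable gT : finGroupType.
Implicit Types (S I : {set gT}) (w x s t : gT) (u v : seq gT).

Lemma gprod_mem S (G : {group gT}) u :
  S \subset G -> all (mem S) u -> gprod u \in G.
Proof.
move=> sSG; elim: u => [|s u IHu] /=; first by rewrite big_nil group1.
by case/andP=> Ss Su; rewrite big_cons groupM ?IHu // (subsetP sSG).
Qed.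

Lemma gen_gprodP S w :
  w \in <<S>> -> exists2 u, all (mem S) u & gprod u = w.
Proof.
case/gen_prodgP=> n [c Sc ->]; exists [seq c i | i <- index_enum 'I_n].
  by apply/allP=> _ /mapP[i _ ->]; apply: Sc.
by rewrite big_map.
Qed.

Lemma word_ofP S n w :
  reflect (exists2 u, all (mem S) u /\ size u = n & gprod u = w) (word_of S n w).
Proof.
apply: (iffP existsP) => [[t /andP[St /eqP Et]] | [u [Su sz] Eu]].
  by exists (val t); rewrite ?size_tuple.
by exists (tcast sz (in_tuple u)); rewrite val_tcast /= Su Eu eqxx.
Qed.

(** A shortest word has pairwise distinct prefix products, so its length is bounded by the group
    order. Hence the bounded search in [clen] succeeds. *)
Lemma short_word S w : w \in <<S>> -> exists2 n, (n <= #|gT|)%N & word_of S n w.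
Proof.
case/gen_gprodP=> u0 Su0 Eu0.
have exn : exists n, word_of S n w by exists (size u0); apply/word_ofP; exists u0.
case: (ex_minnP exn) => n /word_ofP[u [Su sz] Eu] min_n.
exists n; last by apply/word_ofP; exists u.
rewrite leqNgt; apply/negP=> lt_gT_n.
pose pre (i : 'I_n.+1) := gprod (take i u).
have /injectivePn[i [j ne_ij Eij]] : ~~ injectiveb pre.
  apply/negP=> /injectiveP/leq_card; rewrite card_ord => le_n.
  by move: (leq_trans le_n (ltnW lt_gT_n)); rewrite ltnn.
wlog lt_ij : i j ne_ij Eij / (i < j)%N.
  move=> IH; have := ne_ij; rewrite -val_eqE /= neq_ltn => /orP[] lt_ij; first exact: (IH i j).
  by apply: (IH j i) => //; rewrite eq_sym.
have /min_n : word_of S (i + (n - j)) w.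
  apply/word_ofP; exists (take i u ++ drop j u).
    rewrite all_cat size_cat size_drop size_takel ?sz -1?ltnS ?ltn_ord //; split=> //.
    by apply/andP; split; apply/allP=> y; [move/mem_take | move/mem_drop]; apply: (allP Su).
  by rewrite big_cat /= -[X in X * _]/(pre i) Eij -big_cat cat_take_drop.
have := ltn_ord j; lia.
Qed.

End Words.

Section CoxeterSystem.
Variables (gT : finGroupType) (S : {set gT}).
Hypothesis HS : coxeter_system S.
Implicit Types (I : {set gT}) (w x s t : gT) (u v : seq gT).
Local Notation l := (clen S).

Lemma cox_invol s : s \in S -> s * s = 1.
Proof.
case: HS => + _ _ Ss => /(_ s Ss) os; have {}os : #[s] = 2%N by [].
by rewrite -[s * s]/(s ^+ 2) -os expg_order.
Qed.

Lemma cox_invV s : s \in S -> s^-1 = s.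
Proof. by move=> Ss; apply/eqP; rewrite eq_invg_mul cox_invol. Qed.

Let clen_word_of w : word_of S (l w) w.
Proof.
have [_ genS _] := HS.
have [n le_n wn] : exists2 n, (n <= #|gT|)%N & word_of S n w.
  by apply: short_word; rewrite genS inE.
have /(nth_find 0%N) : has (fun n => word_of S n w) (iota 0 #|gT|.+1).
  by apply/hasP; exists n; rewrite // mem_iota.
rewrite nth_iota ?add0n // -[X in (_ < X)%N](size_iota 0) -has_find.
by apply/hasP; exists n; rewrite // mem_iota.
Qed.

Lemma clenP w : exists2 u, all (mem S) u /\ size u = l w & gprod u = w.
Proof. exact/word_ofP/clen_word_of. Qed.

Lemma clen_le u : all (mem S) u -> (l (gprod u) <= size u)%N.
Proof.
move=> Su; rewrite leqNgt; apply/negP=> lt_u.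
have lt_gT : (size u < #|gT|.+1)%N.
  apply: leq_trans lt_u _; rewrite -[X in (_ <= X)%N](size_iota 0); exact: find_size.
have := before_find 0%N lt_u; rewrite nth_iota // add0n.
by move/word_ofP=> []; exists u.
Qed.

Lemma redwordP w :
  [/\ all (mem S) (redword S w), size (redword S w) = l w & gprod (redword S w) = w].
Proof.
rewrite /redword; case: pickP => [t /andP[St /eqP Et] | no]; first by rewrite size_tuple.
by have /existsP[t /= tP] := clen_word_of w; have := no t; rewrite /= tP.
Qed.

Lemma clen1 : l 1 = 0%N.
Proof. by have := @clen_le [::] isT; rewrite big_nil leqn0 => /eqP. Qed.

Lemma clenM_le s w : s \in S -> (l (s * w) <= (l w).+1)%N.
Proof.
move=> Ss; have [u [Su <-] <-] := clenP w.
by have := @clen_le (s :: u); rewrite big_cons /= Ss Su; apply.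
Qed.

(* The cocycle W x W -> Z/2 whose value at (w, t), for a reflection t, is the
   parity of the number of times t occurs among the reflections
   s_1 .. s_i .. s_1 attached to any word s_1 .. s_k of w. It is obtained from
   the action s.(t, e) = (t ^ s, e + [t = s]) on W x Z/2. *)
Lemma reflection_cocycle : exists eta : gT -> gT -> bool,
  (forall x y t, eta (x * y) t = eta x t (+) eta y (t ^ x)) /\
  (forall s t, s \in S -> eta s t = (t == s)).
Proof.
pose fn s (p : gT * bool) := (p.1 ^ s, p.2 (+) (p.1 == s)).
have fnK s : s \in S -> involutive (fn s).
  move=> Ss [t e]; rewrite /fn /= -conjgM cox_invol // conjg1 -addbA.
  have ss : s = s ^ s by rewrite conjgE mulKg.
  by rewrite {3}ss (can_eq (conjgK s)) addbb addbF.
pose act s := if s \in S =P true is ReflectT Ss then perm (can_inj (fnK s Ss)) else 1.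
have actE s p : s \in S -> act s p = fn s p.
  by move=> Ss; rewrite /act; case: eqP => // Ss'; rewrite permE.
have dih s t k p : s \in S -> t \in S ->
    ((act s * act t) ^+ k) p =
    (p.1 ^ ((s * t) ^+ k),
     p.2 (+) odd (\sum_(i < 2 * k) (p.1 == ((s * t) ^+ i * s)%g))%N).
  move=> Ss St; elim: k p => [|k IHk] [r e].
    by rewrite !expg0 perm1 conjg1 muln0 big_ord0 addbF.
  rewrite !expgS permM IHk permM !actE // /fn /= -!conjgM mulnS; congr pair; first by rewrite mulgA.
  rewrite -!addbA; congr (_ (+) _).
  rewrite add2n !big_ord_recl !oddD oddb oddb expg0 mul1g expg1; congr (_ (+) (_ (+) odd _)).
    have Et : t = (s * t * s) ^ s.
      by rewrite conjgE cox_invV // -!mulgA cox_invol // mulg1 mulgA cox_invol // mul1g.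
    by rewrite {1}Et (can_eq (conjgK s)).
  apply: eq_bigr => i _; congr (nat_of_bool _).
  have [c Ec] : exists c, c = s * t by exists (s * t).
  have sc : s * c = t by rewrite Ec mulgA cox_invol // mul1g.
  have ct : c * t = s by rewrite Ec -mulgA cox_invol // mulg1.
  have Ei : c ^+ i * s = (c ^+ i.+2 * s) ^ c.
    by rewrite conjgE expgS -!mulgA mulKg sc expgSr -mulgA ct.
  by rewrite !lift0 -Ec Ei (can_eq (conjgK c)).
have [_ _ /(_ _ act)] := HS.
case=> [s t Ss St | phi phiE].
  apply/permP=> -[r e]; rewrite dih // perm1 expg_order conjg1 /=; congr pair.
  (* The indices i and i + m give the same reflection, m being the order of s t, so the count is
     even. *)
  rewrite mul2n -addnn big_split_ord /= oddD.
  under [X in _ (+) (_ (+) odd X)]eq_bigr do rewrite expgD expg_order mul1g.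
  by rewrite addbb addbF.
exists (fun w t => (phi w (t, false)).2).
have phiP w : forall t e, phi w (t, e) = (t ^ w, e (+) (phi w (t, false)).2).
  have : w \in <<S>> by case: HS => _ -> _; rewrite inE.
  case/gen_gprodP=> u Su <- {w}; elim: u Su => [_ | s u IHu /= /andP[Ss Su]] t e.
    by rewrite big_nil morph1 !perm1 conjg1 addbF.
  rewrite big_cons morphM ?inE // !permM (phiE s) // !actE // /fn /=.
  by rewrite IHu // [in RHS]IHu //= conjgM addbA.
split=> [x y t | s t Ss]; last by rewrite phiE // actE.
by rewrite morphM ?inE // permM [phi x _]phiP phiP /=.
Qed.

(** If the cocycle of [gprod u] at s is odd, then s is one of the reflections of u, and multiplying
    by s deletes the corresponding letter. If it were even, the cocycle of [s * gprod u] at s would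
    be odd, so multiplying that element by s would shorten it, against the hypothesis. *)
Lemma exchange s u : s \in S -> all (mem S) u -> (l (s * gprod u) <= l (gprod u))%N ->
  exists v1 x v2, [/\ u = v1 ++ x :: v2, s = x ^ (gprod v1)^-1 &
                      s * gprod u = gprod (v1 ++ v2)].
Proof.
have [eta [etaM etaS]] := reflection_cocycle.
have eta1 t : eta 1 t = false.
  by have := etaM 1 1 t; rewrite mulg1 conjg1; case: (eta 1 t).
have split_eta v t : all (mem S) v -> eta (gprod v) t ->
    exists v1 x v2, v = v1 ++ x :: v2 /\ t = x ^ (gprod v1)^-1.
  elim: v t => [|x v IHv] t /=; first by rewrite big_nil eta1.
  case/andP=> Sx Sv; rewrite big_cons etaM etaS //.
  have [-> _ | _ /= /(IHv _ Sv)[v1 [y [v2 [-> Et]]]]] := eqVneq t x.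
    by exists [::], x, v; rewrite big_nil invg1 conjg1.
  exists (x :: v1), y, v2; split=> //.
  by rewrite big_cons invMg conjgM -Et -conjgM mulgV conjg1.
have del v t : all (mem S) v -> eta (gprod v) t ->
    exists v1 x v2, [/\ v = v1 ++ x :: v2, t = x ^ (gprod v1)^-1 &
                        t * gprod v = gprod (v1 ++ v2)].
  move=> Sv /(split_eta _ _ Sv)[v1 [x [v2 [Ev Et]]]]; exists v1, x, v2; split=> //.
  have Sx : x \in S by move: Sv; rewrite Ev all_cat /= => /and3P[].
  rewrite Et Ev !big_cat big_cons /= conjgE invgK -!mulgA mulKg.
  by rewrite (mulgA x) cox_invol // mul1g.
have desc v t : all (mem S) v -> eta (gprod v) t -> (l (t * gprod v) < size v)%N.
  move=> Sv /(del _ _ Sv)[v1 [x [v2 [Ev _ ->]]]]; move: Sv; rewrite Ev all_cat /=.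
  case/and3P=> Sv1 _ Sv2; apply: leq_ltn_trans (clen_le _) _; first by rewrite all_cat Sv1.
  by rewrite !size_cat /= addnS.
move=> Ss Su le_l; apply: del => //; case eta_u: (eta _ _) => //.
have [v [Sv sz_v] Ev] := clenP (s * gprod u).
have /(desc v s Sv) : eta (gprod v) s.
  by rewrite Ev etaM etaS // eqxx conjgE mulKg eta_u.
by rewrite Ev mulgA cox_invol // mul1g sz_v ltnNge le_l.
Qed.

Lemma clenM s w : s \in S -> l (s * w) = (l w).+1 \/ l w = (l (s * w)).+1.
Proof.
move=> Ss; have [le_l | lt_l] := leqP (l (s * w)) (l w); last first.
  by left; apply/eqP; rewrite eqn_leq lt_l clenM_le.
right; have [u [Su sz_u] Eu] := clenP w.
have le_l' := le_l; rewrite -Eu in le_l'.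
have [v1 [x [v2 [Ev _ Esu]]]] := exchange Ss Su le_l'.
have := clenM_le (s * w) Ss; rewrite mulgA cox_invol // mul1g => le_w.
apply/eqP; rewrite eqn_leq le_w -sz_u Ev size_cat /= addnS ltnS -size_cat.
rewrite -[in l _]Eu Esu; apply: clen_le; move: Su; rewrite Ev !all_cat /=.
by case/and3P=> -> _ ->.
Qed.

Lemma deletion u : all (mem S) u -> (l (gprod u) < size u)%N ->
  exists v, [/\ subseq v u, (size v < size u)%N & gprod v = gprod u].
Proof.
elim: u => [|s u IHu] //= /andP[Ss Su]; rewrite big_cons ltnS => le_l.
have [/(IHu Su)[v [sub_v sz_v Ev]] | le_u] := ltnP (l (gprod u)) (size u).
  by exists (s :: v); rewrite /= eqxx sub_v ltnS sz_v big_cons Ev.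
have [v1 [x [v2 [Ev _ ->]]]] := exchange Ss Su (leq_trans le_l le_u).
exists (v1 ++ v2); rewrite !size_cat; split=> //; last by rewrite Ev size_cat /= addnS leqW.
apply: subseq_trans (subseq_cons _ _); rewrite Ev cat_subseq //; exact: subseq_cons.
Qed.

Lemma reduced_subword u : all (mem S) u ->
  exists v, [/\ subseq v u, size v = l (gprod u) & gprod v = gprod u].
Proof.
have [n] := ubnP (size u); elim: n u => // n IHn u lt_u Su.
have [/(deletion Su)[v [sub_v sz_v Ev]] | le_u] := ltnP (l (gprod u)) (size u); last first.
  by exists u; split=> //; apply/eqP; rewrite eqn_leq le_u clen_le.
have Sv : all (mem S) v by apply/allP=> x /(mem_subseq sub_v)/(allP Su).
have [v' [sub_v' sz_v' Ev']] := IHn v (leq_trans sz_v lt_u) Sv.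
by exists v'; rewrite -Ev sz_v' Ev'; split=> //; apply: subseq_trans sub_v' sub_v.
Qed.

Lemma parabolic_word I w : I \subset S -> w \in <<I>> ->
  exists2 u, all (mem I) u /\ size u = l w & gprod u = w.
Proof.
move=> sIS /gen_gprodP[u Iu <-].
have Su : all (mem S) u by apply/allP=> x /(allP Iu)/(subsetP sIS).
have [v [sub_v sz_v Ev]] := reduced_subword Su; exists v => //; split=> //.
by apply/allP=> x /(mem_subseq sub_v)/(allP Iu).
Qed.

Lemma clen_gen s : s \in S -> l s = 1%N.
Proof.
by move=> Ss; case: (clenM 1 Ss); rewrite mulg1 clen1 // => [[]].
Qed.

Lemma mem_parabolic I s : I \subset S -> s \in S -> s \in <<I>> -> s \in I.
Proof.
move=> sIS Ss /(parabolic_word sIS)[u []]; rewrite clen_gen //.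
by case: u => [|x [|]] //=; rewrite andbT => Ix _; rewrite big_seq1 => <-.
Qed.

Fixpoint alternating x y n : seq gT :=
  if n is n'.+1 then x :: alternating y x n' else [::].

Lemma all_alternating (a : pred gT) x y n : a x -> a y -> all a (alternating x y n).
Proof. by elim: n x y => //= n IHn x y ax ay; rewrite ax IHn. Qed.

Lemma size_alternating x y n : size (alternating x y n) = n.
Proof. by elim: n x y => //= n IHn x y; rewrite IHn. Qed.

Lemma alternating_order x y : x * x = 1 -> y * y = 1 ->
  gprod (alternating x y #[x * y]) = gprod (alternating y x #[x * y]).
Proof.
move=> x2 y2; suff altE n : gprod (alternating x y n) = (x * y) ^+ n * gprod (alternating y x n).
  by rewrite altE expg_order mul1g.
elim: n x y x2 y2 => [|n IHn] x y x2 y2 /=; first by rewrite expg0 mul1g.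
rewrite !big_cons IHn // expgS -!mulgA; congr (x * _); rewrite !mulgA; congr (_ * _).
by elim: n {IHn} => [|n IHn]; rewrite ?expg0 ?mulg1 ?y2 // !expgS IHn !mulgA.
Qed.

Let alternating_reflection x y n v v1 z v2 : x * x = 1 -> y * y = 1 ->
  alternating x y n ++ v = v1 ++ z :: v2 -> (size v1 < n)%N ->
  z ^ (gprod v1)^-1 = (x * y) ^+ size v1 * x.
Proof.
elim: v1 x y n => [|a v1 IHv] x y [|n] x2 y2 //=.
  by case=> <- _ _; rewrite big_nil invg1 conjg1 mul1g.
case=> <- E; rewrite ltnS => lt_n; rewrite big_cons invMg conjgM (IHv y x n) //.
rewrite conjgE invgK expgS -!mulgA; congr (x * _); rewrite !mulgA.
have -> : x^-1 = x by apply/eqP; rewrite eq_invg_mul x2.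
by congr (_ * x); elim: (size v1) => [|k IHk]; rewrite ?mulg1 ?mul1g // !expgS -!mulgA -IHk !mulgA.
Qed.

(* Obtained by repeatedly prepending the missing descent with the exchange
   condition. *)
Let braid_prefix s t w n : s \in S -> t \in S -> s != t ->
  (l (s * w) < l w)%N -> (l (t * w) < l w)%N -> (n <= #[s * t])%N ->
  exists x y v, [/\ (x, y) = (s, t) \/ (x, y) = (t, s),
    all (mem S) (alternating x y n ++ v), gprod (alternating x y n ++ v) = w &
    size (alternating x y n ++ v) = l w].
Proof.
move=> Ss St ne_st ds dt; elim: n => [_ | n IHn lt_n].
  by have [u [Su sz] Eu] := clenP w; exists s, t, u; split=> //; left.
have [x [y [v [xyE Sv Ew sz]]]] := IHn (ltnW lt_n).
have [Sx Sy oxy dy] : [/\ x \in S, y \in S, #[x * y] = #[s * t] & (l (y * w) < l w)%N].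
  case: xyE => [[-> ->]|[-> ->]]; split=> //.
  by rewrite -orderV invMg !cox_invV.
have := ltnW dy; rewrite -Ew => /(exchange Sy Sv)[v1 [z [v2 [Ev Ey Eyw]]]].
(* A letter deleted inside the alternating part, at position i < n, would give y = (x y)^i x, that
   is (x y)^(i+1) = 1 with i + 1 below the order. *)
have [lt_v1 | le_v1] := ltnP (size v1) n.
  have := alternating_reflection (cox_invol Sx) (cox_invol Sy) Ev lt_v1.
  rewrite -Ey => /(congr1 (mulg^~ y)); rewrite cox_invol // -mulgA -expgSr => /esym/eqP.
  rewrite -order_dvdn oxy => /(dvdn_leq (ltn0Sn _)); lia.
have [v1' Ev1] : exists v1', v1 = alternating x y n ++ v1'.
  exists (drop n v1); move/(congr1 (take n)): Ev.
  by rewrite take_size_cat ?size_alternating // takel_cat // => ->; rewrite cat_take_drop.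
exists y, x, (v1' ++ v2); split; first by case: xyE => [[-> ->]|[-> ->]]; [right | left].
- move: Sv; rewrite Ev Ev1 /= -!catA !all_cat /= Sy; case/and4P=> Sa -> _ ->.
  by rewrite Sa.
- by rewrite /= big_cons catA -Ev1 -Eyw mulgA cox_invol // mul1g Ew.
by rewrite Ew -sz Ev Ev1 /= -!catA !size_cat /= !addnS.
Qed.

Section Matsumoto.
Variables (R : pzRingType) (f : gT -> R).
Hypothesis f_invol : forall s, s \in S -> (f s * f s = 1)%R.
Hypothesis f_order : forall s t, s \in S -> t \in S -> ((f s * f t) ^+ #[s * t] = 1)%R.
Local Notation fprod u := (\prod_(y <- u) f y)%R.

Let f_braid s t : s \in S -> t \in S ->
  fprod (alternating s t #[s * t]) = fprod (alternating t s #[s * t]).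
Proof.
move=> Ss St.
suff altE n : (fprod (alternating s t n) = (f s * f t) ^+ n * fprod (alternating t s n))%R.
  by rewrite altE f_order // mul1r.
elim: n s t Ss St => [|n IHn] x y Sx Sy /=; first by rewrite GRing.expr0 mul1r.
rewrite !big_cons IHn // exprS -!mulrA; congr (_ * _)%R; rewrite !mulrA; congr (_ * _)%R.
by elim: n {IHn} => [|n IHn]; rewrite ?GRing.expr0 ?mulr1 ?f_invol // !exprS IHn !mulrA.
Qed.

(** Words with the same first letter are compared by induction. If the first letters s and t differ,
    both shorten the element, so it has a reduced word starting with the full alternating word in s
    and t. Exchanging the two alternating words preserves both products and links a word starting
    with s to one starting with t. *)
Lemma fprod_reduced u v : all (mem S) u -> all (mem S) v -> gprod u = gprod v ->
  size u = l (gprod u) -> size v = l (gprod v) -> fprod u = fprod v.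
Proof.
have [n] := ubnP (size u); elim: n u v => // n IHn u v lt_u Su Sv Euv sz_u sz_v.
have sz_uv : size u = size v by rewrite sz_u sz_v Euv.
case: u v => [|s u] [|t v] // in lt_u Su Sv Euv sz_u sz_v sz_uv *.
have tl x u' w : all (mem S) (x :: u') -> gprod (x :: u') = w -> size (x :: u') = l w ->
    [/\ x \in S, all (mem S) u', gprod u' = x * w, size u' = l (x * w) & (l (x * w) < l w)%N].
  case/andP=> Sx Su'; rewrite big_cons => Ew /= sz.
  have Eu' : gprod u' = x * w by rewrite -Ew mulgA cox_invol // mul1g.
  have le_u' := clen_le Su'; rewrite Eu' in le_u'.
  split=> //; last by rewrite -sz ltnS.
  by apply/eqP; rewrite eqn_leq le_u' andbT -ltnS sz -{1}(mul1g w) -(cox_invol Sx) -mulgA clenM_le.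
have same x u' v' w : (size u' < n)%N -> all (mem S) (x :: u') -> all (mem S) (x :: v') ->
    gprod (x :: u') = w -> gprod (x :: v') = w -> size (x :: u') = l w ->
    size (x :: v') = l w -> fprod (x :: u') = fprod (x :: v').
  move=> lt_u' /tl Hu /tl Hv /Hu{}Hu /Hv{}Hv /Hu[_ Su' Eu' zu' _] /Hv[_ Sv' Ev' zv' _].
  by rewrite !big_cons; congr (_ * _)%R; apply: IHn; rewrite ?Eu' ?Ev'.
have [Est | ne_st] := eqVneq s t.
  by rewrite Est in Su Euv sz_u *; apply: (same t u v _ _ Su Sv Euv) => //; rewrite -?Euv.
have [Ss Su' _ _ ds] := tl _ _ _ Su erefl sz_u.
have := tl _ _ _ Sv (esym Euv); rewrite -sz_uv => /(_ sz_u)[St _ _ _ dt].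
have [x [y [r [xyE Sr Er zr]]]] := braid_prefix Ss St ne_st ds dt (leqnn _).
have o_st : (0 < #[s * t])%N := order_gt0 _.
have base : [/\ all (mem S) r, gprod (alternating s t #[s * t]) * gprod r = gprod (s :: u) &
   (#[s * t] + size r)%N = size (s :: u)].
  move: Sr Er zr; rewrite all_cat size_cat size_alternating -sz_u big_cat /=.
  case/andP=> _ -> + ->; case: xyE => [[-> ->]|[-> ->]] // <-; split=> //.
  by rewrite (alternating_order (cox_invol Ss) (cox_invol St)).
case: base => Sr' Er' zr'.
have altS a b k : a \in S -> b \in S -> all (mem S) (alternating a b k) by exact: all_alternating.
transitivity (fprod (alternating s t #[s * t] ++ r)).
  move: o_st Er' zr' (altS s t #[s * t] Ss St); case: #[s * t] => //= k _ Er' zr' Sa.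
  apply: (same _ _ _ (gprod (s :: u))) => //.
  - by rewrite -cat_cons all_cat /= Sa.
  - by rewrite -cat_cons big_cat.
  by rewrite -sz_u /= -zr' size_cat size_alternating.
rewrite big_cat f_braid // -big_cat /=.
move: o_st Er' zr' (altS t s #[s * t] St Ss); rewrite (alternating_order (cox_invol Ss) (cox_invol St)).
case: #[s * t] => //= k _ Er' zr' Sa.
have := same t (alternating s t k ++ r) v (gprod (s :: u)).
apply=> //.
- by move: lt_u; rewrite /= size_cat size_alternating ltnS; case: zr' => ->.
- by rewrite -cat_cons all_cat /= Sa.
- by rewrite -cat_cons big_cat.
- by rewrite -sz_u /= -zr' size_cat size_alternating.
by rewrite -sz_u sz_uv.
Qed.

Lemma matsumoto_mul x y :
  (fprod (redword S (x * y)) = fprod (redword S x) * fprod (redword S y))%R.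
Proof.
have step s w : s \in S -> (fprod (redword S (s * w)) = f s * fprod (redword S w))%R.
  have up a b : a \in S -> l (a * b) = (l b).+1 ->
      (fprod (redword S (a * b)) = f a * fprod (redword S b))%R.
    move=> Sa ab; have [Sr zr Er] := redwordP (a * b); have [Sb zb Eb] := redwordP b.
    have -> : (f a * fprod (redword S b) = fprod (a :: redword S b))%R by rewrite big_cons.
    apply: fprod_reduced; rewrite ?Er ?big_cons ?Eb //=.
    - by rewrite Sa.
    by rewrite zb ab.
  move=> Ss; case: (clenM w Ss) => [/up->// | lw].
  have := up s (s * w) Ss; rewrite mulgA cox_invol // mul1g => /(_ lw) ->.
  by rewrite mulrA f_invol // mul1r.
have [Sx _ Ex] := redwordP x; rewrite -{1}Ex; elim: (redword S x) Sx => [|s u IHu] /=.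
  by rewrite !big_nil mul1g mul1r.
by case/andP=> Ss Su; rewrite !big_cons -mulgA step // IHu // mulrA.
Qed.

Lemma matsumoto_gen s : s \in S -> (fprod (redword S s) = f s)%R.
Proof.
move=> Ss; have [Sr zr Er] := redwordP s.
rewrite (@fprod_reduced _ [:: s]) ?big_seq1 ?Er //= ?Ss //.
by rewrite clen_gen.
Qed.

Lemma matsumoto1 : (fprod (redword S 1) = 1)%R.
Proof.
have [_ /eqP + _] := redwordP 1; rewrite clen1 size_eq0 => /eqP ->.
by rewrite big_nil.
Qed.

End Matsumoto.

End CoxeterSystem.

(** * The reflection representation *)

Local Close Scope group_scope.
Local Open Scope ring_scope.

(* Only neighbours in L may fail to commute, and the order of their product
   satisfies a: the Coxeter graph of L is a disjoint union of paths. *)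
Fixpoint linear_seq (gT : finGroupType) (a : pred nat) (L : seq gT) : bool :=
  if L is s :: L' then
    (if L' is t :: L'' then a #[(s * t)%g]%g && all (fun u => #[(s * u)%g]%g == 2%N) L'' else true)
      && linear_seq a L'
  else true.

(** * The numbers cos(pi / m) as real parts of roots of -1 *)

Section Cosine.
Implicit Types (m : nat) (z : algC).

Lemma conj_root_unit m z : (0 < m)%N -> z ^+ m = -1 -> z * z^* = 1.
Proof.
move=> m_gt0 zm; rewrite -normCK -[1](expr1n _ 2); congr (_ ^+ 2).
by apply/eqP; rewrite -(pexpr_eq1 m_gt0) // -normrX zm normrN1.
Qed.

(** Among the roots of -1 in the closed upper half plane, [m.-root] has the largest real part. Were
    it at most 0, then by conjugation all m roots would have real part at most 0. As they sum to 0,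
    all would be purely imaginary and square to -1, which forces z^2 = 1 for a primitive m-th root
    of unity z. *)
Lemma Re_root_gt0 m : (2 < m)%N -> 0 < 'Re (m.-root (-1 : algC)).
Proof.
move=> m_gt2; have m_gt0 : (0 < m)%N by lia.
set x : algC := m.-root _; have xm : x ^+ m = -1 by rewrite rootCK.
rewrite real_ltNge ?Creal_Re ?real0 //; apply/negP=> Rex.
have le0 (y : algC) : y ^+ m = -1 -> 'Re y <= 0.
  move=> ym; wlog Imy : y ym / 0 <= 'Im y; last exact: le_trans (rootC_Re_max m_gt0 ym Imy) Rex.
  have [Imy | Imy] := real_leP (real0 _) (Creal_Im y) => H; first exact: H.
  by rewrite -Re_conj H ?Im_conj ?oppr_ge0 ?ltW // -rmorphXn /= ym rmorphN1.
have [z prim_z] := C_prim_root_exists m_gt0.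
have xzm (k : nat) : (x * z ^+ k) ^+ m = -1.
  by rewrite exprMn xm -exprM mulnC exprM (prim_expr_order prim_z) expr1n mulr1.
have sum0 : \sum_(k < m) 'Re (x * z ^+ k) = 0.
  rewrite -raddf_sum -mulr_sumr.
  suff -> : \sum_(k < m) z ^+ k = 0 by rewrite mulr0 raddf0.
  apply: (mulfI (x := z - 1)); last by rewrite -subrX1 (prim_expr_order prim_z) subrr mulr0.
  rewrite subr_eq0; apply/eqP=> z1; move: prim_z; rewrite z1 => /prim_order_dvd/(_ 1%N).
  by rewrite expr1n eqxx dvdn1 => /eqP; lia.
have Re0 (k : nat) : (k < m)%N -> 'Re (x * z ^+ k) = 0.
  move=> lt_k; apply/eqP; rewrite -oppr_eq0; apply/eqP.
  have := @psumr_eq0P _ 'I_m xpredT (fun k => - 'Re (x * z ^+ k)).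
  move/(_ _ _ (Ordinal lt_k) isT); apply=> [i _|]; first by rewrite oppr_ge0 le0.
  by rewrite sumrN sum0 oppr0.
have sq (k : nat) : (k < m)%N -> (x * z ^+ k) ^+ 2 = -1.
  move=> lt_k; have := conj_root_unit m_gt0 (xzm k); have := Re0 k lt_k.
  rewrite ReE => /eqP; rewrite mulf_eq0 invr_eq0 pnatr_eq0 orbF addr_eq0 => /eqP E.
  by move=> zz; rewrite expr2 {2}E mulrN zz.
have /eqP := sq 1%N ltac:(lia); rewrite expr1 exprMn -[x]mulr1 -(expr0 z) sq //.
rewrite mulN1r eqr_opp -(prim_order_dvd prim_z) => /dvdn_leq; lia.
Qed.

Lemma cosm_spec m : (0 < m)%N -> exists2 z : algC, z ^+ m = -1 &
  [/\ z != 0, cosm m = (z + z^-1) / 2 & (2 < m)%N -> 0 < cosm m].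
Proof.
move=> m_gt0; exists (m.-root (-1)); first by rewrite rootCK.
have zz := conj_root_unit m_gt0 (rootCK m_gt0 (-1)).
have z0 : m.-root (-1 : algC) != 0 by rewrite rootC_eq0 // oppr_eq0 oner_eq0.
split=> //; last exact: Re_root_gt0.
by rewrite /cosm ReE; congr ((_ + _) / _); apply: (mulfI z0); rewrite zz mulfV.
Qed.

Lemma cosm1 : cosm 1 = -1.
Proof.
have [z + [_ -> _]] := cosm_spec (isT : (0 < 1)%N); rewrite expr1 => ->.
by rewrite invrN1 -mulr2n -[_ *+ 2]mulr_natr mulfK ?pnatr_eq0.
Qed.

Lemma cosm2 : cosm 2 = 0.
Proof.
have [z z2 [z0 -> _]] := cosm_spec (isT : (0 < 2)%N).
suff -> : z^-1 = - z by rewrite subrr mul0r.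
by apply: (mulfI z0); rewrite mulfV // mulrN -expr2 z2 opprK.
Qed.

Lemma cosm3 : cosm 3 = 1 / 2.
Proof.
have [z z3 [z0 -> /(_ isT) c_gt0]] := cosm_spec (isT : (0 < 3)%N); congr (_ / _).
have : (z + 1) * (z * (z + z^-1 - 1)) = 0.
  have -> : (z + 1) * (z * (z + z^-1 - 1)) = z ^+ 3 + 1 + (z + 1) * (z * z^-1 - 1) by ring.
  by rewrite z3 mulfV // subrr mulr0 addNr addr0.
move/eqP; rewrite !mulf_eq0 (negPf z0) /= subr_eq0 => /orP[|/eqP//].
rewrite addr_eq0 => /eqP Ez; move: c_gt0; rewrite Ez invrN1 -mulr2n -[_ *+ 2]mulr_natr.
by rewrite mulfK ?pnatr_eq0 // ltr0N1.
Qed.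

End Cosine.

(** * Linear algebra of products of reflections *)

Section Reflections.
Variables (K : fieldType).

(* If a, b are the rank one maps with 1 - a, 1 - b reflections, then
   (1 - a)(1 - b) is annihilated by (X - 1)(X - x)(X - 1/x). *)
Lemma reflections_order n (a b : 'M[K]_n) (x : K) m :
  a *m a = 2 *: a -> b *m b = 2 *: b ->
  a *m b *m a = (2 + x + x^-1) *: a -> b *m a *m b = (2 + x + x^-1) *: b ->
  x ^+ m = 1 -> x != 1 -> x ^+ 2 != 1 -> x != 0 ->
  ((1 - a) * (1 - b)) ^+ m = 1.
Proof.
case: n a b => [|n] a b; first by move=> *; apply/matrixP=> -[].
move=> aa bb aba bab xm x1 x2 x0; set R := (1 - a) * (1 - b).
(* This is (R - x)(R - 1/x) in expanded form. Both a and b kill it from the left, so R fixes it. *)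
pose Z := (2 - x - x^-1) *: 1 - 2 *: a - 2 *: b + a * b + b * a.
have aZ : a * Z = 0.
  rewrite /Z !mulrDr !mulrN -!scalerAr mulr1 !mulrA -![_ * _]/(_ *m _) aa aba -scalemxAl.
  move: (a *m b) => ab; apply/matrixP=> i j; rewrite !mxE; ring.
have bZ : b * Z = 0.
  rewrite /Z !mulrDr !mulrN -!scalerAr mulr1 !mulrA -![_ * _]/(_ *m _) bb bab -scalemxAl.
  move: (b *m a) => ab; apply/matrixP=> i j; rewrite !mxE; ring.
have RZ : R * Z = Z.
  rewrite /R -mulrA [(1 - b) * Z]mulrBl bZ subr0 mul1r mulrBl aZ subr0 mul1r //.
have RR : (R - x%:M) * (R - x^-1%:M) = Z.
  suff E : R * R = (x + x^-1) *: R - 1 + Z.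
    rewrite mulrBl !mulrBr E -![_ * _]/(_ *m _) mul_mx_scalar !mul_scalar_mx scale_scalar_mx mulfV //.
    by apply/matrixP=> i j; rewrite !mxE; ring.
  have inv (c : 'M[K]_n.+1) : c *m c = 2 *: c -> (1 - c) * (1 - c) = 1.
    move=> cc; rewrite mulrBl !mulrBr !mul1r mulr1 -[c * c]/(c *m c) cc.
    by apply/matrixP=> i j; rewrite !mxE; ring.
  have RR' : R * ((1 - b) * (1 - a)) = 1.
    by rewrite /R mulrA -(mulrA (1 - a)) inv // mulr1 inv.
  have -> : R * R = R * (R + (1 - b) * (1 - a) - (x + x^-1) *: 1) + (x + x^-1) *: R - 1.
    by rewrite [R * (_ - _)]mulrBr [R * (_ + _)]mulrDr RR' -scalerAr mulr1 subrK addrK.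
  have -> : R + (1 - b) * (1 - a) - (x + x^-1) *: 1 = Z.
    rewrite /R /Z !mulrBl !mulrBr !mul1r !mulr1.
    by apply/matrixP=> i j; rewrite !mxE; ring.
  by rewrite RZ -addrA addrC.
pose rs := [:: 1; x; x^-1].
have /dvdpP[p Ep] : \prod_(z <- rs) ('X - z%:P) %| 'X^m - 1%:P.
  apply: uniq_roots_dvdp; last rewrite uniq_rootsE.
    by rewrite /= /root !hornerE expr1n exprVn xm invr1 subrr eqxx.
  rewrite /= !inE !negb_or eq_sym x1 /= andbT eq_sym invr_eq1 x1 /=.
  by apply: contra x2 => /eqP Ex; rewrite expr2 {1}Ex mulVf.
apply/eqP; rewrite -subr_eq0; apply/eqP.
transitivity (horner_mx R ('X^m - 1%:P)).
  by rewrite rmorphB rmorphXn /= horner_mx_X horner_mx_C.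
rewrite Ep !big_cons big_nil mulr1 !rmorphM !rmorphB /= horner_mx_X !horner_mx_C.
by rewrite RR mulrBl RZ mul1r subrr mulr0.
Qed.

Lemma div_mul_div (a x y z : K) : a != 0 -> x * y = a * z -> a / z = a / x * (a / y).
Proof. by move=> a0 xy; rewrite mulf_div xy -mulf_div mulfV // mul1r. Qed.

(** The matrix determinant lemma: [E] factors one block matrix in two ways into block triangular
    ones. *)
Lemma det_1_add_rank1 n (c : 'cV[K]_n) (r : 'rV[K]_n) :
  \det (1%:M + c *m r) = 1 + (r *m c) 0 0.
Proof.
have E : block_mx (1%:M : 'M_1) 0 c (1%:M : 'M_n) *m block_mx 1%:M (- r) 0 (1%:M + c *m r)
         = block_mx (1%:M + r *m c) (- r) 0 1%:M *m block_mx 1%:M 0 c 1%:M.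
  rewrite !mulmx_block !mulmx1 !mul1mx !mulmx0 !mul0mx !addr0 !add0r mulNmx addrK.
  by congr block_mx; rewrite mulmxN addrCA addNr addr0.
have := congr1 determinant E; rewrite !det_mulmx !det_lblock !det_ublock !det1 !mul1r !mulr1 => ->.
by rewrite det_mx11 !mxE.
Qed.

(** The hypothesis reads A + B = 1 + A B, whence (1 - q A)(1 - q B) = (1 - q)(1 - q A B). *)
Lemma det_orthogonal n (q : K) (A B : 'M[K]_n) : (A - 1%:M) *m (B - 1%:M) = 0 ->
  \det (1%:M - q *: A) * \det (1%:M - q *: B) = (1 - q) ^+ n * \det (1%:M - q *: (A *m B)).
Proof.
move=> AB; rewrite -det_mulmx -detZ; congr determinant.
move: AB; rewrite !(mulmxBl, mulmxBr) !mulmx1 !mul1mx -!scalemxAl -!scalemxAr.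
move: (A *m B) => C /matrixP H; apply/matrixP=> i j; have := H i j.
rewrite !mxE => E; have -> : C i j = A i j + B i j - (i == j)%:R; last by ring.
by apply/eqP; rewrite -subr_eq0; apply/eqP; rewrite -[RHS]E; ring.
Qed.

End Reflections.

(** * The determinant of 1 - q P for a Coxeter element P of type A *)

Section Chain.
Variables (T : eqType) (K : fieldType) (n : nat) (q : K).
Variables (rt : T -> 'cV[K]_n) (ct : T -> 'rV[K]_n).
Implicit Types (c : seq T) (t : T) (phi : 'rV[K]_n) (e : 'cV[K]_n).
Local Notation refl t := (1%:M - rt t *m ct t).

Definition pair phi e : K := (phi *m e) 0 0.

Lemma pairDl phi psi e : pair (phi + psi) e = pair phi e + pair psi e.
Proof. by rewrite /pair mulmxDl mxE. Qed.

Lemma pairZl x phi e : pair (x *: phi) e = x * pair phi e.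
Proof. by rewrite /pair -scalemxAl mxE. Qed.

Definition only_head (f : T -> K) c : Prop :=
  if c is t :: c' then f t = -1 /\ forall u, u \in c' -> f u = 0 else True.

(** The Cartan matrix of type A along [c], described by its rows and columns in turn. *)
Fixpoint chain_pairing c : Prop := if c is s :: c' then
  [/\ pair (ct s) (rt s) = 2, only_head (fun t => pair (ct s) (rt t)) c',
      only_head (fun t => pair (ct t) (rt s)) c' & chain_pairing c']
  else True.

Lemma row_refl phi t : phi *m refl t = phi - pair phi (rt t) *: ct t.
Proof.
by rewrite mulmxBr mulmx1 mulmxA [phi *m rt t]mx11_scalar mul_scalar_mx.
Qed.

Lemma row_prod_orth phi c : (forall t, t \in c -> pair phi (rt t) = 0) ->
  phi *m \prod_(t <- c) refl t = phi.
Proof.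
elim: c => [|t c IHc] H; first by rewrite big_nil mulmx1.
rewrite big_cons -[_ * _]/(_ *m _) mulmxA row_refl H ?mem_head // scale0r subr0.
by apply: IHc => u cu; rewrite H // inE cu orbT.
Qed.

Lemma only_head_step phi s c : chain_pairing (s :: c) ->
  (forall u, u \in c -> pair phi (rt u) = 0) ->
  only_head (fun t => pair (phi + ct s) (rt t)) c.
Proof.
case: c => // u c [_ [su sv] _ _] phi0; split=> [|v cv].
  by rewrite pairDl phi0 ?mem_head // su add0r.
by rewrite pairDl phi0 ?sv ?addr0 // inE cv orbT.
Qed.

Local Notation row_sum phi c := (phi + \sum_(t <- c) ct t).

Lemma row_prod_chain phi c : chain_pairing c -> only_head (fun t => pair phi (rt t)) c ->
  phi *m \prod_(t <- c) refl t = row_sum phi c.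
Proof.
elim: c phi => [|t c IHc] phi; first by rewrite !big_nil mulmx1 addr0.
move=> chain_tc [pt pu]; rewrite !big_cons -[_ * _]/(_ *m _) mulmxA row_refl pt scaleN1r opprK.
by rewrite IHc ?addrA //; [case: chain_tc | apply: only_head_step].
Qed.

(* A solution of y (1 - q P) = (1 - q ^ (k + 1)) phi P, where P is the product
   of the reflections of the chain c of length k: it is the sum of the
   q ^ (k - i) E_i, where E_i is phi plus the first i roots of c, and P maps
   E_(i+1) to E_i and E_0 to E_k. *)
Fixpoint resolvent phi c : 'rV[K]_n :=
  if c is t :: c' then q ^+ (size c) *: phi + resolvent (phi + ct t) c' else phi.

Lemma pair_resolvent_orth phi e c : (forall t, t \in c -> pair (ct t) e = 0) ->
  pair (resolvent phi c) e = pair phi e * \sum_(i < (size c).+1) q ^+ i.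
Proof.
elim: c phi => [|t c IHc] phi H /=; first by rewrite big_ord_recl big_ord0 addr0 mulr1.
rewrite pairDl pairZl IHc => [|u cu]; last by rewrite H // inE cu orbT.
by rewrite pairDl H ?mem_head // addr0 [in RHS]big_ord_recr /=; ring.
Qed.

Lemma pair_resolvent phi e c : only_head (fun t => pair (ct t) e) c ->
  pair (resolvent phi c) e =
    pair phi e * q ^+ size c + (pair phi e - 1) * \sum_(i < size c) q ^+ i.
Proof.
case: c => [|t c] /=; first by rewrite big_ord0 mulr0 addr0 mulr1.
by case=> te ue; rewrite pairDl pairZl pair_resolvent_orth // pairDl te; ring.
Qed.

Lemma resolventP phi c : chain_pairing c -> only_head (fun t => pair phi (rt t)) c ->
  q *: (resolvent phi c *m \prod_(t <- c) refl t) =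
    resolvent phi c - (1 - q ^+ (size c).+1) *: row_sum phi c.
Proof.
elim: c phi => [|t c IHc] phi.
  by rewrite /= !big_nil mulmx1 addr0 => _ _; apply/matrixP=> i j; rewrite !mxE; ring.
move=> chain_tc [pt pu]; have cond := only_head_step chain_tc pu.
case: chain_tc => tt Hrow Hcol chain_c.
have {IHc} IH := IHc _ chain_c cond; have phiP := row_prod_chain chain_c cond.
have phi0 := row_prod_orth pu; rewrite -phiP in IH.
rewrite [in RHS]big_cons !big_cons -[_ * \prod_(_ <- _) _]/(_ *m _) mulmxA /= mulmxDl.
(* Since [phi + ct t] pairs to 1 with [rt t], the geometric sum of [pair_resolvent] drops out. *)
rewrite [phi + (ct t + _)]addrA -phiP -scalemxAl !row_refl pair_resolvent //.
rewrite pairDl tt pt; have -> : (-1 + 2 : K) = 1 by ring.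
rewrite subrr mul0r addr0 mul1r scaleN1r opprK.
have -> : q ^+ (size c).+1 *: (phi + ct t) + (resolvent (phi + ct t) c - q ^+ size c *: ct t) =
  q ^+ (size c).+1 *: (phi + ct t) + resolvent (phi + ct t) c - q ^+ size c *: ((phi + ct t) - phi).
  by apply/matrixP=> i j; rewrite !mxE; ring.
rewrite mulmxBl mulmxDl scalerBr scalerDr IH -!scalemxAl mulmxBl phi0 !scalerA.
move: (_ *m _) => S; apply/matrixP=> i j; rewrite !mxE !exprS; ring.
Qed.

(** Prepending s is a rank one perturbation: 1 - q (refl s) P = (1 + (rt s) y)(1 - q P), where y is
    a multiple of the [resolvent]. With j = [(size c).+1] for the old chain, the determinant lemma
    gives the new factor (1 - q^(j+1)) / ((1 - q)(1 - q^j)). *)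
Lemma det_chain c : (forall j, 1 - q ^+ j.+1 != 0) -> chain_pairing c ->
  \det (1%:M - q *: \prod_(t <- c) refl t) * (1 - q) ^+ (size c).+1 =
    (1 - q) ^+ n * (1 - q ^+ (size c).+1).
Proof.
move=> q1; elim: c => [_ | s c IHc].
  rewrite big_nil -[X in q *: X]/(1%:M); have -> : 1%:M - q *: 1%:M = (1 - q)%:M :> 'M_n.
    by rewrite scale_scalar_mx mulr1 -raddfB.
  by rewrite det_scalar !expr1.
move=> /[dup] chain_sc [ss Hrow Hcol chain_c].
rewrite big_cons; set P := \prod_(t <- c) _ in IHc *; set j := (size c).+1 in IHc *.
pose y := (q / (1 - q ^+ j)) *: resolvent (ct s) c.
have -> : 1%:M - q *: (refl s * P) = (1%:M + rt s *m y) *m (1%:M - q *: P).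
  have yP : y *m (1%:M - q *: P) = q *: (ct s *m P).
    have RP := resolventP chain_c Hrow; rewrite -/P -/j -row_prod_chain // -/P in RP.
    rewrite /y -scalemxAl mulmxBr mulmx1 -scalemxAr RP.
    by apply/matrixP=> a b; rewrite !mxE; field; rewrite q1.
  rewrite mulmxDl mul1mx -mulmxA yP -[refl s * P]/(refl s *m P) mulmxBl mul1mx -scalemxAr -mulmxA.
  by apply/matrixP=> a b; rewrite !mxE; ring.
rewrite det_mulmx det_1_add_rank1 -/(pair y (rt s)) pairZl pair_resolvent // ss.
rewrite [size (s :: c)]/=  -/j exprS mulrACA [_ * (_ ^+ j)]mulrC.
have geom : (1 - q) * \sum_(i < size c) q ^+ i = 1 - q ^+ size c by rewrite -opprB mulNr -subrX1 opprB.
rewrite [_ * (1 - q)]mulrC mulrCA mulrA.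
rewrite mulrDr mulr1 [(1 - q) * _]mulrCA; have -> : (2 - 1 : K) = 1 by ring.
rewrite mul1r [(1 - q) * (_ + _)]mulrDr geom.
rewrite mulrC mulrA [\det _ * _]mulrC [_ * \det _]mulrC IHc // -/j.
by rewrite /j !exprS; field; rewrite -exprS q1.
Qed.

End Chain.

HB.instance Definition _ := GRing.RMorphism.copy cst (tofracC \o @polyC algC).

(** * The reflection representation and its determinants over K(sqrt q) *)

Section GeometricRep.
Variables (gT : finGroupType) (S : {set gT}).
Hypothesis HS : coxeter_system S.
Implicit Types (s t x y w : gT) (I : {set gT}) (u c : seq gT).
Local Notation N := #|S|.

Definition simple_root s : 'cV[algC]_N := \col_i (enum_val i == s)%:R.
(** The linear form 2 B(alpha_s, -), which makes [refl_mx S s] the identity minus a rank one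
    matrix. *)
Definition simple_coroot s : 'rV[algC]_N := \row_j - (2 * cosm #[(s * enum_val j)%g]%g).

Lemma refl_mxE s : refl_mx S s = 1%:M - simple_root s *m simple_coroot s.
Proof.
apply/matrixP=> i j; rewrite !mxE big_ord1 !mxE /bilin.
by have [-> | _] := eqVneq (enum_val i) s; rewrite ?mul0r // !mul1r mulrN.
Qed.

Lemma pair_roots s t : s \in S -> t \in S ->
  pair (simple_coroot s) (simple_root t) = - (2 * cosm #[(s * t)%g]%g).
Proof.
move=> Ss St; rewrite /pair mxE (bigD1 (enum_rank_in St t)) //= !mxE enum_rankK_in //.
rewrite eqxx mulr1 big1 ?addr0 // => i /negP ne_i; rewrite !mxE.
case: eqP => [Ei | _]; last by rewrite mulr0.
by case: ne_i; apply/eqP/enum_val_inj; rewrite enum_rankK_in.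
Qed.

Lemma pair_root s : s \in S -> pair (simple_coroot s) (simple_root s) = 2.
Proof. by move=> Ss; rewrite pair_roots // (cox_invol HS) // order1 cosm1 mulrN1 opprK. Qed.

Lemma pair_root_comm s t : s \in S -> t \in S -> #[(s * t)%g]%g = 2%N ->
  pair (simple_coroot s) (simple_root t) = 0.
Proof. by move=> Ss St o2; rewrite pair_roots // o2 cosm2 mulr0 oppr0. Qed.

Lemma pair_root_braid s t : s \in S -> t \in S -> #[(s * t)%g]%g = 3%N ->
  pair (simple_coroot s) (simple_root t) = -1.
Proof. by move=> Ss St o3; rewrite pair_roots // o3 cosm3 mul1r mulfV ?pnatr_eq0. Qed.

Lemma order_mulC s t : s \in S -> t \in S -> #[(s * t)%g]%g = #[(t * s)%g]%g.
Proof. by move=> Ss St; rewrite -orderV invMg !(cox_invV HS). Qed.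

Let proj_mul s t x y :
  (simple_root s *m simple_coroot t) *m (simple_root x *m simple_coroot y) =
  pair (simple_coroot t) (simple_root x) *: (simple_root s *m simple_coroot y).
Proof.
rewrite mulmxA -(mulmxA _ (simple_coroot t)) [simple_coroot t *m _]mx11_scalar mul_mx_scalar.
by rewrite -scalemxAl.
Qed.

Lemma refl_mx_invol s : s \in S -> refl_mx S s * refl_mx S s = 1.
Proof.
move=> Ss; rewrite refl_mxE -[_ * _]/(_ *m _) mulmxBl mul1mx mulmxBr mulmx1 proj_mul pair_root //.
by rewrite -[1 in RHS]/(1%:M); apply/matrixP=> i j; rewrite !mxE; ring.
Qed.

Lemma refl_mx_order s t : s \in S -> t \in S ->
  (refl_mx S s * refl_mx S t) ^+ #[(s * t)%g]%g = 1.
Proof.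
move=> Ss St; have m_gt0 : (0 < #[(s * t)%g]%g)%N := order_gt0 _.
have [z zm [z0 cosE cos_gt0]] := cosm_spec m_gt0.
(* Since 4 [cosm]^2 = 2 + z^2 + z^-2, the candidate eigenvalues of the product are 1, z^2 and z^-2.
   They are distinct only for m > 2. For m = 1 the two reflections coincide, for m = 2 they
   commute. *)
have [m_le2 | m_gt2] := leqP #[(s * t)%g]%g 2; last first.
  have pE : pair (simple_coroot s) (simple_root t) * pair (simple_coroot t) (simple_root s) = 2 + z ^+ 2 + (z ^+ 2)^-1.
    by rewrite !pair_roots // (order_mulC St Ss) cosE; field.
  rewrite !refl_mxE; apply: (reflections_order (x := z ^+ 2)).
  - by rewrite proj_mul pair_root.
  - by rewrite proj_mul pair_root.
  - by rewrite proj_mul -scalemxAl proj_mul scalerA pE.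
  - by rewrite proj_mul -scalemxAl proj_mul scalerA mulrC pE.
  - by rewrite -exprM mulnC exprM zm sqrrN expr1n.
  - rewrite sqrf_eq1; apply/negP=> /orP[/eqP Ez | /eqP Ez].
      by move: zm (@ltr01 algC); rewrite Ez expr1n => ->; rewrite ltr0N1.
    have := cos_gt0 m_gt2; rewrite cosE Ez invrN1 -mulr2n -[_ *+ 2]mulr_natr mulfK ?pnatr_eq0 //.
    by rewrite ltr0N1.
  - rewrite sqrf_eq1; apply/negP=> /orP[].
      rewrite sqrf_eq1=> /orP[/eqP Ez | /eqP Ez].
        by move: zm (@ltr01 algC); rewrite Ez expr1n => ->; rewrite ltr0N1.
      have := cos_gt0 m_gt2; rewrite cosE Ez invrN1 -mulr2n -[_ *+ 2]mulr_natr mulfK ?pnatr_eq0 //.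
      by rewrite ltr0N1.
    move=> /eqP Ez; have := cos_gt0 m_gt2; rewrite cosE.
    have -> : z^-1 = - z by apply: (mulfI z0); rewrite mulfV // mulrN -expr2 Ez opprK.
    by rewrite subrr mul0r ltxx.
  by rewrite expf_neq0.
have [o1 | o2] : #[(s * t)%g]%g = 1%N \/ #[(s * t)%g]%g = 2%N.
- by case: #[_]%g m_gt0 m_le2 => [|[|[|k]]]; [|left|right|].
- have -> : t = s.
    by move/eqP: o1; rewrite order_eq1 => /eqP st; rewrite -(mulKg s t) st mulg1 (cox_invV HS).
  by rewrite refl_mx_invol // expr1n.
rewrite o2 expr2 mulrA -(mulrA (refl_mx S s)).
have -> : refl_mx S t * refl_mx S s = refl_mx S s * refl_mx S t.
  rewrite !refl_mxE -![_ * _]/(_ *m _) !mulmxBl !mul1mx !mulmxBr !mulmx1 !proj_mul.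
  rewrite !pair_root_comm // ?scale0r ?subr0; last by rewrite (order_mulC St Ss).
  by rewrite -!addrA; congr (_ + _); rewrite addrC.
by rewrite mulrA refl_mx_invol // mul1r refl_mx_invol.
Qed.

Definition geomF w : 'M[Fq]_N := map_mx cst (geom_rep S w).
Definition rootF s : 'cV[Fq]_N := map_mx cst (simple_root s).
Definition corootF s : 'rV[Fq]_N := map_mx cst (simple_coroot s).

Lemma geomFM x y : geomF (x * y)%g = geomF x *m geomF y.
Proof.
by rewrite /geomF /geom_rep (matsumoto_mul HS) ?map_mxM //; [exact: refl_mx_invol | exact: refl_mx_order].
Qed.

Lemma geomF1 : geomF 1%g = 1%:M.
Proof. by rewrite /geomF /geom_rep (matsumoto1 HS) map_mx1. Qed.

Lemma geomF_gen s : s \in S -> geomF s = 1%:M - rootF s *m corootF s.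
Proof.
move=> Ss; rewrite /geomF /geom_rep (matsumoto_gen HS) //; [|exact: refl_mx_invol|exact: refl_mx_order].
by rewrite refl_mxE map_mxB map_mx1 map_mxM.
Qed.

Lemma geomF_prod u : all (mem S) u -> geomF (gprod u) = \prod_(t <- u) (1%:M - rootF t *m corootF t).
Proof.
elim: u => [|s u IHu] /=; first by rewrite !big_nil geomF1.
by case/andP=> Ss Su; rewrite !big_cons geomFM geomF_gen // IHu.
Qed.

Lemma pairF s t : pair (corootF s) (rootF t) = cst (pair (simple_coroot s) (simple_root t)).
Proof. by rewrite /pair -map_mxM mxE. Qed.

Lemma qq_neq1 j : 1 - qq ^+ j.+1 != 0.
Proof.
rewrite /qq -exprM /uq -tofracXn -tofrac1 -tofracB tofrac_eq0.
apply/eqP=> /(congr1 (horner^~ 0)); rewrite !hornerE expr0n /= subr0 => /eqP.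
by rewrite oner_eq0.
Qed.

(* The right-hand side of the theorem, up to the factor P(q) *)
Definition invdet w : Fq := (1 - qq) ^+ N / \det (1%:M - qq *: geomF w).

Lemma invdet_conj w x : invdet (w ^ x)%g = invdet w.
Proof.
have VX : geomF x^-1 *m geomF x = 1%:M by rewrite -geomFM mulVg geomF1.
suff E : \det (1%:M - qq *: geomF (w ^ x)%g) = \det (1%:M - qq *: geomF w) by rewrite /invdet E.
rewrite conjgE !geomFM; have -> : 1%:M - qq *: (geomF x^-1 *m (geomF w *m geomF x)) =
    geomF x^-1 *m (1%:M - qq *: geomF w) *m geomF x.
  by rewrite mulmxBr mulmx1 mulmxBl VX -scalemxAr -scalemxAl mulmxA.
by rewrite !det_mulmx mulrAC -det_mulmx VX det1 mul1r.
Qed.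

(** Elements of the subgroup of I fix every root of K, and y - 1 has its image in the span of these
    roots, so (x - 1)(y - 1) = 0 and [det_orthogonal] applies. *)
Lemma invdetM (I K : {set gT}) x y : I \subset S -> K \subset S ->
    (forall s t, s \in I -> t \in K -> #[(s * t)%g]%g = 2%N) ->
  x \in <<I>>%g -> y \in <<K>>%g -> invdet (x * y)%g = invdet x * invdet y.
Proof.
move=> sIS sKS comm /gen_gprodP[u Iu <-{x}] /gen_gprodP[v Kv <-{y}].
have fix_root t : t \in K -> geomF (gprod u) *m rootF t = rootF t.
  move=> Kt; elim: u Iu => [|s u IHu] /=; first by rewrite big_nil geomF1 mul1mx.
  case/andP=> Is Iu; have Ss := subsetP sIS s Is; have St := subsetP sKS t Kt.
  rewrite big_cons geomFM -mulmxA IHu // geomF_gen //.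
  rewrite mulmxBl mul1mx -mulmxA [corootF s *m _]mx11_scalar -/(pair _ _) pairF.
  by rewrite pair_root_comm ?comm // [cst 0]rmorph0 raddf0 mulmx0 subr0.
have orth : (geomF (gprod u) - 1%:M) *m (geomF (gprod v) - 1%:M) = 0.
  elim: v Kv => [|t v IHv] /=; first by rewrite big_nil geomF1 subrr mulmx0.
  case/andP=> Kt Kv; rewrite big_cons geomFM (geomF_gen (subsetP sKS _ Kt)).
  rewrite [(1%:M - _) *m geomF _]mulmxBl mul1mx addrAC mulmxBr IHv // sub0r -!mulmxA [_ *m (rootF t *m _)]mulmxA.
  rewrite mulmxBl mul1mx fix_root //.
  by rewrite subrr mul0mx oppr0.
have := det_orthogonal qq orth; rewrite /invdet geomFM => E.
have q0 : (1 - qq) ^+ N != 0 := expf_neq0 _ (qq_neq1 0).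
exact: div_mul_div q0 E.
Qed.

Lemma invdet_chain c : all (mem S) c -> linear_seq (pred1 3%N) c ->
  invdet (gprod c) = (1 - qq) ^+ (size c).+1 / (1 - qq ^+ (size c).+1).
Proof.
move=> Sc lin_c; have chain_c : chain_pairing rootF corootF c.
  elim: c Sc lin_c => //= s c IHc /andP[Ss Sc] /andP[lin_sc lin_c]; split; last exact: IHc.
  - by rewrite pairF pair_root // rmorph_nat.
  - case: c Sc lin_sc {IHc lin_c} => //= t c /andP[St Sc] /andP[/eqP o3 o2].
    split=> [|v cv]; first by rewrite pairF pair_root_braid // rmorphN1.
    have Sv := allP Sc _ cv; have ov := eqP (allP o2 _ cv).
    by rewrite pairF pair_root_comm // [cst 0]rmorph0.
  case: c Sc lin_sc {IHc lin_c} => //= t c /andP[St Sc] /andP[/eqP o3 o2].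
  split=> [|v cv]; first by rewrite pairF pair_root_braid ?rmorphN1 // order_mulC.
  have Sv := allP Sc _ cv; have := eqP (allP o2 _ cv); rewrite order_mulC // => ov.
  by rewrite pairF pair_root_comm // [cst 0]rmorph0.
have := det_chain qq_neq1 chain_c; rewrite -geomF_prod // /invdet => E.
have q0 k : (1 - qq) ^+ k != 0 := expf_neq0 _ (qq_neq1 0).
have D0 : \det (1%:M - qq *: geomF (gprod c)) != 0.
  by apply: contraTneq (mulf_neq0 (q0 N) (qq_neq1 (size c))) => D0; rewrite -E D0 mul0r eqxx.
by apply/eqP; rewrite eqr_div ?qq_neq1 // -E mulrC.
Qed.

End GeometricRep.

(** * Parabolic subgroups of type A *)

Local Close Scope ring_scope.
Local Open Scope group_scope.

Notation par L := <<[set x in L]>>.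
(** Order 2 between neighbours marks a break between two paths. Allowing it makes the class closed
    under sublists: letters that become neighbours by a deletion commute. *)
Notation linear23 := (linear_seq (pred2 2%N 3%N)).
Notation chain := (linear_seq (pred1 3%N)).

Section Parabolic.
Variables (gT : finGroupType).
Implicit Types (s t p x y w : gT) (L M u c : seq gT).

Lemma par_word L w : w \in par L -> exists2 u, {subset u <= L} & gprod u = w.
Proof.
by case/gen_gprodP=> u Lu Eu; exists u => // x /(allP Lu); rewrite /= inE.
Qed.

Lemma mem_par L x : x \in L -> x \in par L.
Proof. by move=> Lx; rewrite mem_gen // inE. Qed.

Lemma gprod_par L u : {subset u <= L} -> gprod u \in par L.
Proof.
move=> sub; rewrite (@gprod_mem _ [set x in L] (<<[set x in L]>>)%G) ?subset_gen //.
by apply/allP=> x /sub; rewrite /= inE.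
Qed.

Lemma par_sub L M : {subset L <= M} -> {subset par L <= par M}.
Proof.
by move=> sub; apply/subsetP/genS/subsetP=> x; rewrite !inE => /sub.
Qed.

Lemma par_nil x : x \in par [::] -> x = 1.
Proof. by case/par_word=> -[|y u] sub <-; [rewrite big_nil | have := sub y (mem_head _ _)]. Qed.

Lemma commute_par p L x : {in L, forall t, commute p t} -> x \in par L -> commute p x.
Proof.
move=> comm Lx; apply/cent1P; rewrite cent1C; apply: subsetP Lx; rewrite gen_subG.
by apply/subsetP=> t; rewrite inE => /comm ct; apply/cent1P.
Qed.

Lemma linear_cat a c L : linear_seq a c -> linear_seq a L ->
  (forall s t, s \in c -> t \in L -> #[s * t] = 2%N) -> a 2%N -> linear_seq a (c ++ L).
Proof.
move=> + lin_L + a2; elim: c => [|s c IHc] //= /andP[lin_sc lin_c] comm.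
rewrite IHc // ?andbT => [|x y cx]; last by apply: comm; rewrite inE cx orbT.
have commL t : t \in L -> #[s * t] = 2%N by move=> Lt; apply: comm; rewrite ?mem_head.
case: c lin_sc {IHc lin_c comm} => [|t c] /=.
  case: L commL {lin_L} => // t L commL _; rewrite commL ?mem_head // a2.
  by apply/allP=> u Lu; rewrite commL ?eqxx // inE Lu orbT.
by case/andP=> -> oc; rewrite all_cat oc; apply/allP=> u /commL ->.
Qed.

Lemma linear_cat_r a u v : linear_seq a (u ++ v) -> linear_seq a v.
Proof. by elim: u => //= s u IHu /andP[_]. Qed.

Lemma linear_cat_l a u v : linear_seq a (u ++ v) -> linear_seq a u.
Proof.
elim: u => //= s u IHu /andP[lin_s /IHu->]; rewrite andbT.
by case: u lin_s {IHu} => //= t u; rewrite all_cat => /and3P[-> ->].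
Qed.

Lemma chain_far a u s v x y : linear_seq a (u ++ s :: v) -> x \in u -> y \in v -> #[x * y] = 2%N.
Proof.
elim: u => //= t u IHu /andP[lin_t lin_u]; rewrite inE => /orP[/eqP-> vy | ]; last exact: IHu.
apply/eqP; case: u lin_t {IHu lin_u} => /= [|b u] /andP[_ /allP]; apply => //.
by rewrite mem_cat inE vy !orbT.
Qed.

Lemma linear_sub a b L : subpred a b -> linear_seq a L -> linear_seq b L.
Proof.
move=> ab; elim: L => //= s L IHL /andP[lin_s /IHL->]; rewrite andbT.
by case: L lin_s {IHL} => //= t L /andP[/ab-> ->].
Qed.

Lemma subseq_linear23 M L : subseq M L -> linear23 L -> linear23 M.
Proof.
elim: L M => [|s L IHL] [|t M] //=; case: eqP => [-> | _] sub /andP[lin_s lin_L]; last exact: (IHL (t :: M)).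
rewrite IHL // andbT; case: M sub => // u M.
case: L lin_s {IHL lin_L} => //= v L /andP[ov oL].
have ML x : subseq (x :: M) L -> {subset M <= L}.
  by move/mem_subseq=> sub y My; apply: sub; rewrite inE My orbT.
case: eqP => [-> sub | _ sub].
  by rewrite ov; apply/allP=> x /(mem_subseq sub)/(allP oL).
rewrite (eqP (allP oL _ _)) /=; last by apply: (mem_subseq sub); rewrite mem_head.
by apply/allP=> x /(ML _ sub)/(allP oL).
Qed.

End Parabolic.

(** * Newton's identity for the coefficients 1 / [n]_q! *)

Section QExponential.
Variables (K : fieldType) (q : K).
Local Open Scope ring_scope.
Hypothesis q_neq1 : forall j, 1 - q ^+ j.+1 != 0.

(* 1 / [n]_q!, the coefficients of the q-exponential series; they and the
   power sums below are the values of the complete and power sum symmetric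
   functions at (1 - q) q ^ i, for i >= 0, and are related by Newton's identity. *)
Definition qexp_coef n : K := \prod_(i < n) ((1 - q) / (1 - q ^+ i.+1)).
Definition qpower_sum n : K := (1 - q) ^+ n / (1 - q ^+ n).

Lemma qexp_coefS n : qexp_coef n.+1 * (1 - q ^+ n.+1) = qexp_coef n * (1 - q).
Proof. by rewrite /qexp_coef big_ord_recr /= -mulrA divfK. Qed.

(** Multiply by 1 - q^(n+1) = (1 - q^j) + q^j (1 - q^(n+1-j)). The first summand lowers the index of
    [qexp_coef] and leads to the induction hypothesis; the second turns the power sum into a power
    of 1 - q, and the resulting sum is evaluated by [tail]. *)
Lemma qexp_newton n : \sum_(j < n) qexp_coef j * qpower_sum (n - j) = n%:R * qexp_coef n.
Proof.
elim: n => [|n IHn]; first by rewrite big_ord0 mul0r.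
have tail m : \sum_(j < m.+1) qexp_coef j * q ^+ j * (1 - q) ^+ (m.+1 - j) = (1 - q) * qexp_coef m.
  elim: m => [|m IHm]; first by rewrite big_ord_recl big_ord0 /qexp_coef big_ord0 subn0; ring.
  rewrite big_ord_recr /= subSnn.
  have -> : \sum_(j < m.+1) qexp_coef j * q ^+ j * (1 - q) ^+ (m.+2 - j) = (1 - q) * ((1 - q) * qexp_coef m).
    by rewrite -IHm mulr_sumr; apply: eq_bigr => j _; rewrite subSn 1?ltnW // exprS; ring.
  have E := qexp_coefS m; have {E} -> : (1 - q) * qexp_coef m = qexp_coef m.+1 * (1 - q ^+ m.+1) by rewrite E mulrC.
  by ring.
apply: (mulIf (q_neq1 n)); rewrite -mulrA qexp_coefS.
have step k : (0 < k)%N -> qpower_sum k * q ^+ k = qpower_sum k - (1 - q) ^+ k.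
  by case: k => // k _; rewrite /qpower_sum; field; apply: q_neq1.
have -> : (\sum_(j < n.+1) qexp_coef j * qpower_sum (n.+1 - j)) * (1 - q ^+ n.+1) =
    \sum_(j < n.+1) qexp_coef j * (1 - q ^+ j) * qpower_sum (n.+1 - j) +
    \sum_(j < n.+1) qexp_coef j * q ^+ j * (1 - q) ^+ (n.+1 - j).
  rewrite mulr_suml -big_split /=; apply: eq_bigr => j _.
  have lt_j : (0 < n.+1 - j)%N by rewrite subn_gt0.
  have -> : q ^+ n.+1 = q ^+ j * q ^+ (n.+1 - j) by rewrite -exprD subnKC // ltnW.
  have := step _ lt_j; move: (qpower_sum _) (q ^+ (n.+1 - j)) ((1 - q) ^+ _) => x y z E.
  have -> : z = x - x * y by rewrite E; ring.
  by ring.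
rewrite tail big_ord_recl expr0 subrr mulr0 mul0r add0r.
rewrite (eq_bigr (fun j : 'I_n => (1 - q) * (qexp_coef j * qpower_sum (n - j)))) => [|j _].
  by rewrite -mulr_sumr IHn; ring.
by rewrite lift0 qexp_coefS subSS; ring.
Qed.

Lemma qexp_newtonS n :
  \sum_(j < n.+1) qexp_coef j * qpower_sum (n - j).+1 = n.+1%:R * qexp_coef n.+1.
Proof. by rewrite -qexp_newton; apply: eq_bigr => j _; rewrite subSn // -ltnS. Qed.

End QExponential.

(** * Double cosets and conjugacy for linear lists *)

Section LinearLists.
Variables (gT : finGroupType) (S : {set gT}).
Hypothesis HS : coxeter_system S.
Implicit Types (s t p x y w : gT) (L M u v c : seq gT).
Local Notation l := (clen S).

Lemma order2_commute s t : s \in S -> t \in S -> #[s * t] = 2%N -> commute s t.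
Proof.
move=> Ss St o2; have := expg_order (s * t); rewrite o2 expgS expg1 => /eqP.
by rewrite -eq_invg_mul invMg !(cox_invV HS) // => /eqP.
Qed.

Lemma order3_braid s t : s \in S -> t \in S -> #[s * t] = 3%N -> s * t * s = t * s * t.
Proof.
move=> Ss St o3; have := expg_order (s * t); rewrite o3 !expgS expg0 mulg1 => E.
have /eqP : (s * t * s) * (t * s * t) = 1 by rewrite -!mulgA in E *.
by rewrite -eq_invg_mul !invMg !(cox_invV HS) // mulgA => /eqP.
Qed.

Lemma linear23_notin s L : s \in S -> linear23 (s :: L) -> s \notin L.
Proof.
move=> Ss /= /andP[lin_s _]; apply/negP=> Ls.
have o1 : #[s * s] = 1%N by rewrite (cox_invol HS) // order1.
case: L lin_s Ls => // t L /andP[o23 oL]; rewrite inE => /orP[/eqP st | Ls].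
  by move: o23; rewrite -st o1.
by have := allP oL _ Ls; rewrite o1.
Qed.

Lemma linear23_prefix_notin u z v : all (mem S) (u ++ z :: v) -> linear23 (u ++ z :: v) -> z \notin u.
Proof.
elim: u => //= a u IHu /andP[Sa Su] /[dup] lin /andP[_ lin_u].
rewrite inE negb_or IHu // andbT; apply: contraNneq (linear23_notin Sa lin) => <-.
by rewrite mem_cat mem_head orbT.
Qed.

Lemma par_S L s : all (mem S) L -> s \in S -> s \in par L -> s \in L.
Proof.
move=> SL Ss /(mem_parabolic HS)/=; rewrite inE; apply=> //.
by apply/subsetP=> x; rewrite inE => /(allP SL).
Qed.

Lemma head_commute s t L : all (mem S) (s :: t :: L) -> linear23 (s :: t :: L) ->
  {in par L, forall x, commute s x}.
Proof.
case/and3P=> Ss St SL /andP[/andP[_ oL] _] x; apply: commute_par => u Lu.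
by apply: order2_commute => //; [apply: (allP SL) | apply/eqP/(allP oL)].
Qed.

(** Induction on a word. The case that matters is s a s b: by the statement for the shorter list, a
    is either in [par L] without t, hence commutes with s, or a1 t a2 with a1, a2 commuting with s;
    then s t s becomes t or t s t. *)
Lemma double_coset s L w : all (mem S) (s :: L) -> linear23 (s :: L) -> w \in par (s :: L) ->
  w \in par L \/ exists x y, [/\ x \in par L, y \in par L & w = x * s * y].
Proof.
elim: L s w => [|t L IHL] s w SsL lin_sL /par_word[u sub <-{w}].
  elim: u sub => [|x u IHu] sub; first by left; rewrite big_nil group1.
  have /IHu{IHu} : {subset u <= [:: s]} by move=> y uy; apply: sub; rewrite inE uy orbT.
  have := sub x (mem_head _ _); rewrite big_cons inE => /eqP->.
  move=> [H | [a [b [/par_nil-> Hb ->]]]].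
    by right; exists 1, (gprod u); rewrite group1 mul1g.
  by left; rewrite mul1g mulgA (cox_invol HS) ?mul1g //; case/andP: SsL.
have [Ss StL lin_tL] : [/\ s \in S, all (mem S) (t :: L) & linear23 (t :: L)].
  by split; [case/andP: SsL | case/andP: SsL | case/andP: lin_sL].
have St : t \in S by case/andP: StL.
have Pt : t \in par (t :: L) by rewrite mem_par ?mem_head.
have subL : {subset par L <= par (t :: L)} by apply: par_sub => x Lx; rewrite inE Lx orbT.
have comm := head_commute SsL lin_sL.
elim: u sub => [|x u IHu] sub; first by left; rewrite big_nil group1.
have {}IHu := IHu (fun y uy => sub y (mem_behead (s := x :: u) uy)).
have := sub x (mem_head _ _); rewrite big_cons inE => /orP[/eqP-> | tLx]; last first.
  have Px := mem_par tLx; case: IHu => [Pu | [a [b [Pa Pb ->]]]]; first by left; rewrite groupM.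
  by right; exists (x * a), b; rewrite !mulgA groupM.
case: IHu => [Pu | [a [b [Pa Pb ->]]]]; first by right; exists 1, (gprod u); rewrite mul1g group1.
have [La | [a1 [a2 [La1 La2 ->]]]] := IHL t a StL lin_tL Pa.
  by left; rewrite !mulgA (comm _ La) -(mulgA a) (cox_invol HS) // mulg1 groupM.
have -> : s * (a1 * t * a2 * s * b) = a1 * (s * t * s) * (a2 * b).
  by rewrite !mulgA (comm _ La1) -!mulgA; do 3!congr (_ * _); rewrite !mulgA (comm _ La2).
have [] : (#[s * t] == 2) || (#[s * t] == 3) by case/andP: lin_sL => /andP[].
have [Ma1 Ma2] := (subL _ La1, subL _ La2).
case/orP=> /eqP o; [left | right].
  by rewrite (order2_commute Ss St o) -(mulgA t) (cox_invol HS) // mulg1 !groupM.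
exists (a1 * t), (t * (a2 * b)); rewrite !groupM //; split=> //.
by rewrite (order3_braid Ss St o) !mulgA.
Qed.

(** Otherwise x = a t b with a and b commuting with s, so s x s = a t s t b, and solving for s puts
    it in [par (t :: L)]. *)
Lemma conj_mem_behead s t L x : all (mem S) (s :: t :: L) -> linear23 (s :: t :: L) ->
  #[s * t] = 3%N -> x \in par (t :: L) -> s * x * s \in par (t :: L) -> x \in par L.
Proof.
move=> SstL lin o3 Px Psxs; have comm := head_commute SstL lin.
case/and3P: (SstL) => Ss St SL; case/andP: (SstL) => _ StL; case/andP: (lin) => _ lin_tL.
have Pt : t \in par (t :: L) by rewrite mem_par ?mem_head.
have subL : {subset par L <= par (t :: L)} by apply: par_sub => y Ly; rewrite inE Ly orbT.
have [// | [a [b [La Lb Ex]]]] := double_coset StL lin_tL Px.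
case/negP: (linear23_notin Ss lin); apply: par_S => //.
have Es : s * x * s = a * t * s * (t * b).
  transitivity (a * (s * t * s) * b); last by rewrite (order3_braid Ss St o3) !mulgA.
  by rewrite Ex !mulgA (comm _ La) -!mulgA; do 3!congr (_ * _); rewrite (comm _ Lb).
have -> : s = (a * t)^-1 * (s * x * s) * (t * b)^-1 by rewrite Es -(mulgA (a * t)) mulKg mulgK.
have [Ma Mb] := (subL _ La, subL _ Lb).
by apply: groupM; [apply: groupM => //|]; rewrite groupV groupM.
Qed.

(* The prefix p is the part of the word already in normal form; the case of
   interest is p = 1. *)
Lemma conj_subseq p L y : all (mem S) L -> linear23 L ->
  {in behead L, forall t, commute p t} -> y \in par L ->
  exists x M, [/\ x \in par L, subseq M L & (p * y) ^ x = p * gprod M].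
Proof.
elim: L p y => [|s L IHL] p y SsL lin comm Py.
  by exists 1, [::]; rewrite group1 (par_nil Py) big_nil mulg1 conjg1.
have [Ss SL lin_L] : [/\ s \in S, all (mem S) L & linear23 L].
  by split; [case/andP: SsL | case/andP: SsL | case/andP: lin].
have subL : {subset par L <= par (s :: L)} by apply: par_sub => z Lz; rewrite inE Lz orbT.
have commL : {in par L, forall z, commute p z} by move=> z; apply: commute_par.
have [Ly | [a [b [La Lb ->]]]] := double_coset SsL lin Py.
  have [t Lt|x [M [Lx sM Ex]]] := IHL 1 y SL lin_L _ Ly; first exact/commute_sym/commute1.
  exists x, M; split; [exact: subL | exact: subseq_trans sM (subseq_cons _ _) |].
  rewrite !mul1g in Ex; rewrite conjMg Ex; congr (_ * _).
  by apply/conjg_fixP/commgP; apply: commL.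
have comm_ps : {in behead L, forall t, commute (p * s) t}.
  case: L SsL lin comm {IHL SL lin_L subL commL La Lb Py} => // t L SsL lin comm u Lu /=.
  apply/commute_sym/commuteM; apply/commute_sym.
    by apply: comm; rewrite inE Lu orbT.
  by apply: (head_commute SsL lin); rewrite mem_par.
(* As p commutes with a, conjugating p a s b by a gives (p s)(b a), and p s is the prefix for the
   induction. *)
have [x [M [Lx sM Ex]]] := IHL (p * s) (b * a) SL lin_L comm_ps (groupM Lb La).
exists (a * x), (s :: M); rewrite groupM ?subL //; split=> //; first by rewrite /= eqxx.
rewrite big_cons [p * (s * _)]mulgA -Ex conjgM; congr (_ ^ x).
have -> : p * (a * s * b) = a * (p * s * b) by rewrite !mulgA (commL _ La).
by rewrite conjgE -mulgA mulKg mulgA.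
Qed.

End LinearLists.

(** * Sums over type A parabolic subgroups *)

Section Sums.
Variables (gT : finGroupType) (S : {set gT}).
Hypothesis HS : coxeter_system S.
Variable (K : fieldType).
Implicit Types (s t p x y w : gT) (L M u v c B : seq gT).
Local Notation l := (clen S).

(** By induction f vanishes at products of proper sublists of M, so on [par M] it takes no values
    but 0 and f (gprod M). The sum is then a multiple of the latter, and in characteristic 0 the
    multiplicity cannot vanish. *)
Lemma class_function_vanish L (f : gT -> K) :
  (forall n, n.+1%:R != 0 :> K)%R -> all (mem S) L -> linear23 L ->
  (forall x y, f (x ^ y) = f x) ->
  (forall I : {set gT}, I \subset [set x in L] -> \sum_(w in <<I>>) f w = 0)%R ->
  forall w, w \in par L -> f w = 0%R.
Proof.
move=> char0 SL lin_L fJ sum0; suff vanish M w : subseq M L -> w \in par M -> f w = 0%R.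
  by move=> w; apply: vanish.
have [n] := ubnP (size M); elim: n M w => // n IHn M w lt_M sM Mw.
have SM : all (mem S) M by apply/allP=> x /(mem_subseq sM)/(allP SL).
have lin_M := subseq_linear23 sM lin_L.
have val x : x \in par M -> f x = 0%R \/ f x = f (gprod M).
  move=> Mx; have [t _|y [M' [_ sM' E]]] := conj_subseq HS (p := 1) SM lin_M _ Mx.
    exact/commute_sym/commute1.
  rewrite !mul1g in E; rewrite -(fJ x y) E.
  have [EM | neM] := eqVneq M' M; first by right; rewrite EM.
  left; apply: (IHn M'); last by apply: gprod_par.
    have [le_M' eq_M'] := size_subseq_leqif sM'.
    have lt_M' : (size M' < size M)%N by rewrite ltn_neqAle eq_M' neM le_M'.
    exact: leq_trans lt_M' lt_M.
  exact: subseq_trans sM' sM.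
apply/eqP; apply: contraT => fw0; have fM : f w = f (gprod M).
  by case: (val w Mw) fw0 => // ->; rewrite eqxx.
have := sum0 [set x in M]; rewrite (bigID (fun x => f x == 0%R)) /= => /(_ _)/eqP.
rewrite big1 => [|x /andP[_ /eqP]//]; rewrite add0r.
rewrite (eq_bigr (fun=> f w)) => [|x /andP[/val[->|->//]]]; last by rewrite eqxx.
rewrite sumr_const -mulr_natr mulf_eq0 (negPf fw0) /= => H.
have /H : [set x in M] \subset [set x in L].
  by apply/subsetP=> x; rewrite !inE; apply: mem_subseq.
by rewrite (cardD1 w) unfold_in /= Mw fw0 /= (negPf (char0 _)).
Qed.

(* The map (x, y) -> x s y from H x H onto H s H has all fibers of size #|H'|. *)
Lemma sum_double_coset (H H' W : {group gT}) s (f : gT -> K) : s * s = 1 -> s \notin H ->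
  (forall x, x \in H -> (s * x * s \in H) = (x \in H')) -> H' \subset H ->
  (forall w, (w \in W) && (w \notin H) <-> exists x y, [/\ x \in H, y \in H & w = x * s * y]) ->
  (\sum_(x in H) \sum_(y in H) f (x * s * y)%g =
   #|H'|%:R * \sum_(w in W | w \notin H) f w)%R.
Proof.
move=> s2 Hs HsH sH'H WP.
have sV : s^-1 = s by apply/eqP; rewrite eq_invg_mul s2.
have inner x : x \in H -> (\sum_(y in H) f (x * s * y)%g = \sum_(w | (s * x^-1 * w)%g \in H) f w)%R.
  move=> Hx; rewrite [RHS](reindex_inj (mulgI (x * s))) /=; apply: eq_bigl => y.
  by rewrite !mulgA -(mulgA s) mulVg mulg1 s2 mul1g.
rewrite (eq_bigr _ inner) (exchange_big_dep xpredT) //= mulr_sumr.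
rewrite big_mkcond /= [RHS]big_mkcond /=; apply: eq_bigr => w _.
(* For w = a s b the admissible x form the coset a H'. *)
have fiber : (exists x y, [/\ x \in H, y \in H & w = x * s * y]) ->
    #|[pred x | (x \in H) && (s * x^-1 * w \in H)]| = #|H'|.
  case=> a [b [Ha Hb ->]]; rewrite -(card_lcoset H' a); apply: eq_card => x.
  have -> : (x \in a *: H') = (x^-1 * a \in H') by rewrite mem_lcoset -groupV invMg invgK.
  have E : x \in H -> (s * x^-1 * (a * s * b) \in H) = (x^-1 * a \in H').
    by move=> Hx; rewrite !mulgA groupMr // -(mulgA s x^-1) HsH // groupM ?groupV.
  rewrite inE; apply/andP/idP => [[Hx] | H'x]; first by rewrite E.
  suff Hx : x \in H by rewrite E.
  by rewrite -groupV -(groupMr _ Ha) (subsetP sH'H).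
have [/WP/fiber E | nw] := boolP ((w \in W) && (w \notin H)); last first.
  rewrite big_pred0 // => x; apply: contraNF nw => /andP[Hx Hsw]; apply/WP.
  by exists x, (s * x^-1 * w); split=> //; rewrite !mulgA -(mulgA x) s2 mulg1 mulgV mul1g.
by rewrite sumr_const E mulr_natl.
Qed.

Definition poincare_on (q : K) (A : {set gT}) : K := (\sum_(w in A) q ^+ l w)%R.

Section Chain.
Variables (B : seq gT).
Hypotheses (SB : all (mem S) B) (linB : linear23 B).

Definition orthogonal_to c := forall s t, s \in c -> t \in B -> #[s * t] = 2%N.

Lemma linear_chain_cat c : chain c -> orthogonal_to c -> linear23 (c ++ B).
Proof.
move=> chain_c orth; apply: linear_cat => //.
by apply: linear_sub chain_c => n /eqP->.
Qed.

Lemma orthogonal_behead s c : orthogonal_to (s :: c) -> orthogonal_to c.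
Proof. by move=> orth x y cx; apply: orth; rewrite inE cx orbT. Qed.

Lemma head_commute_cat s c : all (mem S) (s :: c) -> chain (s :: c) -> orthogonal_to (s :: c) ->
  {in behead c ++ B, forall x, commute s x}.
Proof.
case/andP=> Ss Sc /= /andP[chain_s _] orth x; rewrite mem_cat => /orP[].
  case: c Sc chain_s {orth} => //= t c /andP[St Sc] /andP[_ oc] cx.
  by apply: (order2_commute HS) => //; [apply: (allP Sc) | apply/eqP/(allP oc)].
by move=> Bx; apply: (order2_commute HS) => //; [apply: (allP SB) | apply: orth; rewrite ?mem_head].
Qed.

Lemma notin_cat s c : all (mem S) (s :: c) -> chain (s :: c) -> orthogonal_to (s :: c) ->
  s \notin par (c ++ B).
Proof.
move=> Ssc chain_c orth; have lin := linear_chain_cat chain_c orth.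
have [Ss Sc] : s \in S /\ all (mem S) c by apply/andP.
apply: contra (linear23_notin HS Ss lin) => Ps.
by apply: (par_S HS) Ps => //; rewrite all_cat Sc.
Qed.

Lemma conj_mem_behead_cat s c x : all (mem S) (s :: c) -> chain (s :: c) -> orthogonal_to (s :: c) ->
  x \in par (c ++ B) -> s * x * s \in par (c ++ B) -> x \in par (behead c ++ B).
Proof.
case: c => // t c Sstc chain_c orth; apply: (conj_mem_behead HS (s := s) (t := t)).
- by rewrite -!cat_cons all_cat Sstc.
- exact: (linear_chain_cat chain_c orth).
by case/andP: chain_c => /andP[/eqP].
Qed.

Lemma par_cat_sub c : {subset par (behead c ++ B) <= par (c ++ B)}.
Proof. by apply: par_sub => x; rewrite !mem_cat => /orP[/mem_behead->|->] //; rewrite orbT. Qed.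

Hypothesis char0 : (forall n, n.+1%:R != 0 :> K)%R.

(* For a chain s_1 .. s_n, the elements s_i .. s_1, for 0 <= i <= n, represent
   the left cosets of the parabolic subgroup obtained by removing s_1. *)
Lemma sum_chain c (f : gT -> K) : all (mem S) c -> chain c -> orthogonal_to c ->
  (\sum_(w in par (c ++ B)) f w =
   \sum_(i < (size c).+1) \sum_(y in par (behead c ++ B)) f (gprod (rev (take i c)) * y)%g)%R.
Proof.
elim: c f => [|s c IHc] f Ssc chain_sc orth.
  by rewrite big_ord_recl big_ord0 addr0; apply: eq_bigr => w _; rewrite big_nil mul1g.
have [Ss Sc] : s \in S /\ all (mem S) c by apply/andP.
have chain_c : chain c by case/andP: chain_sc.
have orth_c := orthogonal_behead orth.
have s2 := cox_invol HS Ss; have sV := cox_invV HS Ss.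
have nPs := notin_cat Ssc chain_sc orth.
have subP : {subset par (c ++ B) <= par (s :: c ++ B)} := @par_cat_sub (s :: c).
have Ps : s \in par (s :: c ++ B) by rewrite mem_par ?mem_head.
have comm : {in par (behead c ++ B), forall x, commute s x}.
  by move=> x; apply: commute_par; apply: head_commute_cat.
rewrite big_ord_recl take0 /= /rev /= big_nil.
under [X in (_ = X + _)%R]eq_bigr do rewrite mul1g.
rewrite (bigID (mem (par (c ++ B)))) /=; congr (_ + _)%R.
  by apply: eq_bigl => x; rewrite andb_idl //; apply: subP.
have := @sum_double_coset <<[set x in c ++ B]>> <<[set x in behead c ++ B]>>
  <<[set x in s :: c ++ B]>> s f s2 nPs.
rewrite (IHc (fun x => \sum_(y in par (c ++ B)) f (x * s * y)%g)%R) // => E.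
have card0 : (#|par (behead c ++ B)|%:R != 0 :> K)%R.
  by rewrite (cardD1 1) group1; apply: char0.
apply: (mulfI card0); rewrite -E {E} => [|x Px||w]; first last.
- split=> [/andP[Pw nPw] | [x [y [Px Py ->]]]].
    have SscB : all (mem S) (s :: c ++ B) by rewrite -cat_cons all_cat Ssc.
    by case: (double_coset HS SscB (linear_chain_cat chain_sc orth) Pw) => // /(negP nPw).
  apply/andP; split; first by rewrite !groupM ?(subP _ Px) ?(subP _ Py).
  by apply: contra nPs; rewrite groupMr // groupMl.
- by apply/subsetP; apply: par_cat_sub.
- apply/idP/idP=> [|Px']; first exact: (conj_mem_behead_cat Ssc chain_sc orth Px).
  by rewrite (comm _ Px') -mulgA s2 mulg1.
rewrite mulr_sumr; apply: eq_bigr => i _.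
(* Since h commutes with s, it passes to the right of s and is absorbed by y, so every h contributes
   the same sum. *)
rewrite mulr_natl -sumr_const; apply: eq_bigr => h Ph.
rewrite [RHS](reindex_inj (mulgI h)) /=; apply: eq_big => [y | y _].
  by rewrite groupMl // par_cat_sub.
rewrite -[catrev _ _]/(rev (s :: take i c)) rev_cons -cats1 big_cat big_seq1.
by rewrite -!mulgA (mulgA s) (comm _ Ph) -!mulgA.
Qed.

Lemma card_chain s c : all (mem S) (s :: c) -> chain (s :: c) -> orthogonal_to (s :: c) ->
  (#|par (s :: c ++ B)|%:R = (size c).+2%:R * #|par (c ++ B)|%:R :> K)%R.
Proof.
move=> Ssc chain_sc orth; rewrite -!sum1_card !natr_sum.
rewrite (sum_chain (c := s :: c)) // sumr_const card_ord mulr_natl.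
by congr (_ *+ _)%R; apply: eq_bigr.
Qed.

(** Induction on u: if the conjugate by its first letter s stayed in the subgroup,
    [conj_mem_behead_cat] would put the shorter conjugate into the next smaller one. *)
Lemma chain_reflection_notin u z v : all (mem S) (u ++ z :: v) -> chain (u ++ z :: v) ->
  orthogonal_to (u ++ z :: v) -> gprod u * z * (gprod u)^-1 \notin par (behead (u ++ z :: v) ++ B).
Proof.
elim: u => [|s u IHu] Sc chain_c orth.
  by rewrite big_nil mul1g invg1 mulg1; apply: notin_cat.
have [Ss Sc'] : s \in S /\ all (mem S) (u ++ z :: v) by apply/andP.
have chain_c' : chain (u ++ z :: v) by case/andP: chain_c.
have orth' := orthogonal_behead orth.
have Px : gprod u * z * (gprod u)^-1 \in par ((u ++ z :: v) ++ B).
  have sub y : y \in u ++ [:: z] -> y \in (u ++ z :: v) ++ B.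
    by rewrite !mem_cat !inE => /orP[->|->] //; rewrite orbT.
  rewrite !groupM ?groupV ?gprod_par // => [y uy||y uy]; try by apply: sub; rewrite mem_cat uy.
  by apply/mem_par/sub; rewrite mem_cat mem_head orbT.
apply: contra (IHu Sc' chain_c' orth') => Psxs.
apply: (conj_mem_behead_cat Sc chain_c orth Px).
by move: Psxs; rewrite big_cons invMg (cox_invV HS Ss) !mulgA.
Qed.

(** The coset representatives have minimal length. If prepending z shortened the element, the
    exchange condition would delete a letter of [rev u], so that z lies in [par u], or a letter of
    y, which contradicts [chain_reflection_notin]. *)
Lemma clen_chain u v y : all (mem S) (u ++ v) -> chain (u ++ v) -> orthogonal_to (u ++ v) ->
  y \in par (behead (u ++ v) ++ B) -> l (gprod (rev u) * y) = (size u + l y)%N.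
Proof.
elim/last_ind: u v => [|u z IHu] v; first by rewrite big_nil mul1g.
rewrite cat_rcons size_rcons rev_rcons big_cons => Sc chain_c orth Py.
have {}IHu := IHu _ Sc chain_c orth Py.
have [Su Sz] : all (mem S) u /\ z \in S by move: Sc; rewrite all_cat => /and3P[].
rewrite -mulgA; case: (clenM HS (gprod (rev u) * y) Sz) => [-> | lt_z]; first by rewrite IHu.
have subS : [set x in behead (u ++ z :: v) ++ B] \subset S.
  by apply/subsetP=> x; rewrite inE mem_cat => /orP[/mem_behead/(allP Sc) | /(allP SB)].
have [yw [yS sz_y] Ey] := parabolic_word HS subS Py.
have Sw : all (mem S) (rev u ++ yw).
  by rewrite all_cat all_rev Su; apply/allP=> x /(allP yS)/(subsetP subS).
have [|v1 [x [v2 [Ev Ez _]]]] := exchange HS Sz Sw; first by rewrite big_cat /= Ey lt_z.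
have uV : (gprod u)^-1 = gprod (rev u).
  elim: (u) Su => [|a b IHb] /=; first by rewrite !big_nil invg1.
  by case/andP=> Sa Sb; rewrite big_cons invMg IHb // rev_cons -cats1 big_cat big_seq1 (cox_invV HS).
have [lt_v1 | le_v1] := ltnP (size v1) (size u).
  have chain_in : {subset v1 <= u} /\ x \in u.
    have E : take (size v1).+1 (rev u) = rcons v1 x.
      have := congr1 (take (size v1).+1) Ev; rewrite takel_cat ?size_rev // => ->.
      by rewrite -cat_rcons take_size_cat ?size_rcons.
    have sub a : a \in rcons v1 x -> a \in u by rewrite -E => /mem_take; rewrite mem_rev.
    by split=> [a va|]; apply: sub; rewrite mem_rcons inE ?va ?eqxx ?orbT.
  suff Pz : z \in par u.
    have zu : z \in u by apply: (par_S HS) Pz.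
    have lin : linear23 (u ++ z :: v) by apply: linear_sub chain_c => n /eqP->.
    by have := linear23_prefix_notin HS Sc lin; rewrite zu.
  case: chain_in => sub_v1 ux; rewrite Ez groupJ ?groupV ?gprod_par ?mem_par //.
have [v1' Ev1] : exists v1', v1 = rev u ++ v1'.
  exists (drop (size u) v1); move/(congr1 (take (size u))): Ev.
  by rewrite take_size_cat ?size_rev // takel_cat // => ->; rewrite cat_take_drop.
case/negP: (chain_reflection_notin Sc chain_c orth).
move: Ev; rewrite Ev1 -catA => /eqP; rewrite eqseq_cat // eqxx /= => /eqP Eyw.
have sub a : a \in v1' ++ [:: x] -> a \in behead (u ++ z :: v) ++ B.
  move=> va; have /(allP yS) : a \in yw by move: va; rewrite Eyw !mem_cat !inE => /orP[->|->]; rewrite ?orbT.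
  by rewrite /= inE.
have -> : gprod u * z * (gprod u)^-1 = x ^ (gprod v1')^-1.
  by rewrite Ez Ev1 big_cat /= -uV invMg invgK conjgM [_ ^ gprod u]conjgE mulKVg mulgK.
rewrite groupJ ?groupV ?gprod_par // => [|a va]; last by apply: sub; rewrite mem_cat va.
by apply/mem_par/sub; rewrite mem_cat mem_head orbT.
Qed.

Lemma poincare_on_chain q s c : all (mem S) (s :: c) -> chain (s :: c) -> orthogonal_to (s :: c) ->
  (poincare_on q (par (s :: c ++ B)) * (1 - q) = (1 - q ^+ (size c).+2) * poincare_on q (par (c ++ B)))%R.
Proof.
move=> Ssc chain_sc orth; rewrite /poincare_on (sum_chain (c := s :: c)) //.
rewrite (eq_bigr (fun i : 'I__ => q ^+ i * poincare_on q (par (c ++ B)))%R) => [|i _].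
  by rewrite -mulr_suml mulrAC; congr (_ * _)%R; rewrite -[RHS]opprB subrX1 -mulNr opprB mulrC.
rewrite /poincare_on mulr_sumr; apply: eq_bigr => y Py.
rewrite -exprD (clen_chain (v := drop i (s :: c))) ?cat_take_drop //.
by rewrite size_takel // -ltnS ltn_ord.
Qed.

Section Molien.
Variable (q : K).
Hypothesis q_neq1 : (forall j, 1 - q ^+ j.+1 != 0)%R.
Local Notation h := (qexp_coef q).
Local Notation pw := (qpower_sum q).

Lemma card_chain_cat c : all (mem S) c -> chain c -> orthogonal_to c ->
  (#|par (c ++ B)|%:R = (size c).+1`!%:R * #|par B|%:R :> K)%R.
Proof.
elim: c => [|s c IHc]; first by rewrite mul1r.
move=> Ssc chain_sc orth; rewrite card_chain // IHc ?factS ?natrM ?mulrA //.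
- by case/andP: Ssc.
- by case/andP: chain_sc.
exact: orthogonal_behead orth.
Qed.

Lemma poincare_on_chain_cat c : all (mem S) c -> chain c -> orthogonal_to c ->
  (poincare_on q (par (c ++ B)) * h (size c).+1 = poincare_on q (par B))%R.
Proof.
elim: c => [_ _ _|s c IHc Ssc chain_sc orth].
  by rewrite /qexp_coef big_ord_recl big_ord0 !expr1 divff ?mulr1 // -(expr1 q) q_neq1.
have Sc : all (mem S) c by case/andP: Ssc.
have chain_c : chain c by case/andP: chain_sc.
apply: (mulIf (q_neq1 (size c).+1)); rewrite -[LHS]mulrA qexp_coefS // mulrCA.
have E := poincare_on_chain q Ssc chain_sc orth; rewrite [(poincare_on q _ * (1 - q))%R]E.
rewrite mulrCA mulrC; congr (_ * _)%R; rewrite mulrC IHc //.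
exact: orthogonal_behead orth.
Qed.

Variable (F : gT -> K).
Hypothesis FJ : forall x y, F (x ^ y) = F x.
Hypothesis Fchain : forall c, all (mem S) c -> chain c -> F (gprod c) = pw (size c).+1.
Hypothesis FM : forall (I I' : {set gT}) x y, I \subset S -> I' \subset S ->
  (forall s t, s \in I -> t \in I' -> #[s * t] = 2%N) ->
  x \in <<I>> -> y \in <<I'>> -> (F (x * y)%g = F x * F y)%R.

Lemma F_par L M x y : all (mem S) L -> all (mem S) M ->
  (forall s t, s \in L -> t \in M -> #[s * t] = 2%N) ->
  x \in par L -> y \in par M -> (F (x * y)%g = F x * F y)%R.
Proof.
move=> /allP SL /allP SM comm; apply: FM => [||s t]; rewrite ?inE; last exact: comm.
  by apply/subsetP=> z; rewrite inE => /SL.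
by apply/subsetP=> z; rewrite inE => /SM.
Qed.

(** The prefix v stands for a cycle under construction. In the coset expansion along the first
    letter s of the chain, the trivial coset closes this cycle and contributes its power sum; every
    other coset lengthens v by s. *)
Lemma sum_prefix_chain v c : all (mem S) (v ++ c) -> chain (v ++ c) -> orthogonal_to (v ++ c) ->
  (\sum_(y in par (c ++ B)) F (gprod v * y)%g =
   (\sum_(y in par B) F y) * (size c)`!%:R *
     \sum_(j < (size c).+1) h j * pw (size v + size c - j).+1)%R.
Proof.
elim: c v => [|s c IHc] v.
  rewrite cats0 /= => Sv chain_v orth; rewrite big_ord_recl big_ord0 addr0 /= mulr1 addn0 subn0.
  rewrite /qexp_coef big_ord0 mul1r -Fchain // mulrC mulr_sumr; apply: eq_bigr => y By.
  by apply: (F_par Sv SB orth) => //; apply: gprod_par.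
move=> Svc chain_vc orth.
have [Sv Ssc] : all (mem S) v /\ all (mem S) (s :: c) by apply/andP; rewrite -all_cat.
have [Ss Sc] : s \in S /\ all (mem S) c by apply/andP.
have chain_sc : chain (s :: c) := linear_cat_r chain_vc.
have chain_c : chain c by case/andP: chain_sc.
have orth_sc : orthogonal_to (s :: c) by move=> x y cx; apply: orth; rewrite mem_cat cx orbT.
have orth_c := orthogonal_behead orth_sc.
have ScB : all (mem S) (c ++ B) by rewrite all_cat Sc.
have far x y : x \in v -> y \in c ++ B -> #[x * y] = 2%N.
  move=> vx; rewrite mem_cat => /orP[|By]; first exact: (chain_far chain_vc).
  by apply: orth; rewrite // mem_cat vx.
have vP : gprod v \in par v by apply: gprod_par.
have comm_v : {in par (c ++ B), forall y, commute (gprod v) y}.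
  move=> y Py; apply: commute_par Py => t ct; apply/commute_sym; apply: (@commute_par _ t v) => // x vx.
  by apply/commute_sym/(order2_commute HS); [exact: (allP Sv) | exact: (allP ScB) | exact: far].
rewrite (sum_chain (c := s :: c)) // big_ord_recl take0 /rev /= big_nil.
(* The sum over [par (c ++ B)] comes from the induction hypothesis with empty prefix, in closed form
   by Newton's identity. *)
have first_term : (\sum_(y in par (c ++ B)) F (gprod v * (1 * y))%g =
    pw (size v).+1 * ((\sum_(y in par B) F y) * ((size c).+1`!%:R * h (size c).+1)))%R.
  transitivity (F (gprod v) * \sum_(y in par (c ++ B)) F y)%R.
    by rewrite mulr_sumr; apply: eq_bigr => y Py; rewrite mul1g (F_par Sv ScB far).
  have chain_v : chain v := linear_cat_l chain_vc.
  rewrite (Fchain Sv chain_v); congr (_ * _)%R.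
  have -> : ((size c).+1`!%:R * h (size c).+1 = (size c)`!%:R * \sum_(j < (size c).+1) h j * pw (size c - j).+1)%R.
    by rewrite qexp_newtonS // factS natrM; ring.
  rewrite mulrA.
  refine (etrans _ (IHc [::] Sc chain_c orth_c)); rewrite big_nil.
  by apply: eq_bigr => y _; rewrite mul1g.
rewrite first_term.
(* The representative is e s with e in [par (c ++ B)]. As e commutes with the product of v,
   conjugation by e moves it to the right end, where y absorbs it. *)
have other (i : 'I_(size c).+1) :
    (\sum_(y in par (c ++ B)) F (gprod v * (gprod (catrev (take (0 + i) c) [:: s]) * y))%g =
     \sum_(y in par (c ++ B)) F (gprod (rcons v s) * y)%g)%R.
  set e := gprod (rev (take i c)).
  have Pe : e \in par (c ++ B).
    by apply: gprod_par => x; rewrite mem_rev mem_cat => /mem_take ->.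
  rewrite [RHS](reindex_inj (mulIg e)) /=; apply: eq_big => [y | y Py]; first by rewrite groupMr.
  rewrite -[catrev _ _]/(rev (s :: take i c)) rev_cons -!cats1 !big_cat !big_seq1 -/e -(FJ _ e).
  congr F; rewrite conjgE !mulgA -(mulgA e^-1) (comm_v _ Pe) mulKg //.
rewrite (eq_bigr _ (fun i _ => other i)) sumr_const card_ord -mulr_natr.
rewrite IHc ?cat_rcons // size_rcons.
rewrite [in RHS]big_ord_recr /= addnK factS natrM.
have -> : (\sum_(j < (size c).+1) h j * pw ((size v).+1 + size c - j).+1 =
    \sum_(j < (size c).+1) h j * pw (size v + (size c).+1 - j).+1)%R.
  by apply: eq_bigr => j _; rewrite addSnnS.
by ring.
Qed.

Lemma sum_chain_cat c : all (mem S) c -> chain c -> orthogonal_to c ->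
  (\sum_(y in par (c ++ B)) F y =
   (\sum_(y in par B) F y) * (size c).+1`!%:R * h (size c).+1)%R.
Proof.
move=> Sc chain_c orth; rewrite -mulrA.
have -> : ((size c).+1`!%:R * h (size c).+1 = (size c)`!%:R * \sum_(j < (size c).+1) h j * pw (size c - j).+1)%R.
  by rewrite qexp_newtonS // factS natrM; ring.
rewrite mulrA; refine (etrans _ (@sum_prefix_chain [::] c Sc chain_c orth)).
by rewrite big_nil; apply: eq_bigr => y _; rewrite mul1g.
Qed.

End Molien.

End Chain.

Lemma chain_decomposition s L : linear23 (s :: L) -> exists c B,
  [/\ L = c ++ B, chain (s :: c) & forall x y, x \in s :: c -> y \in B -> #[x * y] = 2%N].
Proof.
elim: L s => [|t L IHL] s lin; first by exists [::], [::].
case/andP: (lin) => /andP[o_st /allP oL] lin_tL.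
have [c [B [E chain_c orth]]] := IHL t lin_tL.
have oL2 x : x \in L -> #[s * x] = 2%N by move/oL/eqP.
case/orP: o_st => /eqP o_st.
  exists [::], (t :: L); split=> // x y; rewrite !inE => /eqP-> /orP[/eqP->|/oL2] //.
exists (t :: c), B; split; first by rewrite E.
  rewrite [chain _]/= o_st eqxx /=; apply/andP; split=> //.
  by apply/allP=> x cx; rewrite oL2 // E mem_cat cx.
move=> x y; rewrite inE => /orP[/eqP-> By | cx By]; last exact: orth.
by apply: oL2; rewrite E mem_cat By orbT.
Qed.

(** Chains are peeled off one at a time. A chain with k letters multiplies the sum of F by (k+1)!
    h_(k+1), the Poincaré polynomial by 1 / h_(k+1) and the order by (k+1)!. *)
Lemma molien_linear q (F : gT -> K) :
  (forall n, n.+1%:R != 0 :> K)%R -> (forall j, 1 - q ^+ j.+1 != 0)%R ->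
  (forall x y, F (x ^ y) = F x) ->
  (forall c, all (mem S) c -> chain c -> F (gprod c) = qpower_sum q (size c).+1) ->
  (forall (I I' : {set gT}) x y, I \subset S -> I' \subset S ->
    (forall s t, s \in I -> t \in I' -> #[s * t] = 2%N) ->
    x \in <<I>> -> y \in <<I'>> -> (F (x * y)%g = F x * F y)%R) ->
  forall L, all (mem S) L -> linear23 L ->
  ((\sum_(w in par L) F w) * poincare_on q (par L) = #|par L|%:R)%R.
Proof.
move=> char0 q1 FJ Fchain FM L; have [n] := ubnP (size L); elim: n L => // n IHn L.
case: L => [_ _ _|s L lt_L SL lin_L].
  have par1 : par [::] = 1 :> {set gT}.
    by apply/setP=> x; apply/idP/set1P=> [/par_nil//|->]; rewrite group1.
  rewrite /poincare_on par1 !big_set1 cards1 clen1 // mulr1.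
  have := Fchain [::] isT isT; rewrite big_nil => ->.
  by rewrite /qpower_sum !expr1 divff // -(expr1 q) q1.
have [c [B [E chain_c orth]]] := chain_decomposition lin_L.
move: SL lin_L lt_L; rewrite E -cat_cons all_cat => /andP[Sc SB] lin lt_cB.
have lin_B := linear_cat_r lin.
rewrite (sum_chain_cat SB lin_B char0 q1 FJ Fchain FM Sc chain_c orth).
rewrite -mulrA [(qexp_coef _ _ * _)%R]mulrC (poincare_on_chain_cat SB lin_B char0 q1 Sc chain_c orth).
rewrite mulrAC IHn //; last first.
  by move: lt_cB; rewrite size_cat /= addSn ltnS; apply: leq_ltn_trans; apply: leq_addl.
by rewrite (card_chain_cat SB lin_B char0 Sc chain_c orth) mulrC.
Qed.

End Sums.

(** * From type A components to linear lists *)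

Section TypeA.
Variables (gT : finGroupType) (S : {set gT}).
Hypothesis HS : coxeter_system S.
Implicit Types (J : {set gT}) (c L : seq gT).

Lemma typeA_path_chain c : typeA_path c -> chain c.
Proof.
case/andP=> uniq_c /forallP/= ord; have {}ord i j : (i < j < size c)%N ->
    #[nth 1 c i * nth 1 c j] = (if i.+1 == j then 3 else 2)%N.
  case/andP=> lt_ij lt_j; have lt_i := ltn_trans lt_ij lt_j.
  have /forallP/(_ (Ordinal lt_j))/implyP := ord (Ordinal lt_i).
  rewrite -val_eqE /= ltn_eqF // => /(_ isT)/eqP ->.
  by case: eqP => //= _; case: eqP => // E; move: lt_ij; lia.
elim: c {uniq_c} ord => //= s c IHc ord; apply/andP; split; last first.
  by apply: IHc => i j ltij; have := ord i.+1 j.+1; apply.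
case: c ord {IHc} => //= t c ord; rewrite (ord 0%N 1%N) //=.
by apply/(all_nthP 1) => i lt_i; have := ord 0%N i.+2; rewrite /= => ->.
Qed.

Lemma typeA_linear J : J \subset S -> all_components_typeA J ->
  exists L, linear23 L /\ [set x in L] = J.
Proof.
move=> sJS typeA; pose closedJ (J' : {set gT}) :=
  forall s t, s \in J' -> connect (cox_edge J) s t -> t \in J'.
have oC s t : s \in J -> t \in J -> #[s * t] = #[t * s].
  by move=> Js Jt; apply: (order_mulC HS); apply: (subsetP sJS).
have symJ : symmetric (cox_edge J).
  move=> s t; rewrite /cox_edge; case Js: (s \in J); case Jt: (t \in J) => //=.
  by rewrite oC.
have csym := sym_connect_sym symJ.
have order2 s t : s \in J -> t \in J -> ~~ connect (cox_edge J) s t -> #[s * t] = 2%N.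
  move=> Js Jt nst; have : ~~ (2 < #[s * t]).
    by apply: contra nst => o3; apply: connect1; rewrite /cox_edge Js Jt.
  have : #[s * t] != 1%N.
    apply: contra nst => o1; move: o1; rewrite order_eq1 -eq_invg_mul => /eqP <-.
    by rewrite (cox_invV HS) ?(subsetP sJS) // connect0.
  by have := order_gt0 (s * t); lia.
(* The induction removes one component at a time, so it runs over unions of components. Letters of
   different components have a product of order 2: order 1 makes them equal and order at least 3 is
   an edge. *)
suff main J' : J' \subset J -> closedJ J' -> exists L, linear23 L /\ [set x in L] = J'.
  apply: main => // s t Js /connectP[p]; elim: p s Js => [|u p IHp] s Js /=; first by move=> _ ->.
  by case/andP=> /and3P[_ Ju _]; apply: IHp.
have [n] := ubnP #|J'|; elim: n J' => // n IHn J' lt_J' sJ'J clJ'.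
have [-> | [s J's]] := set_0Vmem J'.
  by exists [::]; split=> //; apply/setP=> x; rewrite !inE.
have Js := subsetP sJ'J _ J's; have [c [path_c Ec]] := typeA s Js.
have Ccomp x : (x \in c) = connect (cox_edge J) s x.
  by have /setP/(_ x) := Ec; rewrite !inE.
have cJ' : [set x in c] \subset J'.
  by apply/subsetP=> x; rewrite inE Ccomp; apply: clJ'.
have [||| L [lin_L EL]] := IHn (J' :\: [set x in c]).
- rewrite -ltnS (leq_trans _ lt_J') // ltnS; apply/proper_card/properP; split; first exact: subsetDl.
  by exists s; rewrite // !inE Ccomp connect0.
- exact: subset_trans (subsetDl _ _) sJ'J.
- move=> x y; rewrite !inE !Ccomp => /andP[nsx J'x] xy; rewrite (clJ' x) // andbT.
  by apply: contra nsx => sy; apply: connect_trans sy _; rewrite csym.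
have LE x : (x \in L) = (x \notin c) && (x \in J').
  by have /setP/(_ x) := EL; rewrite !inE.
exists (c ++ L); split; last first.
  apply/setP=> x; rewrite inE mem_cat LE; case cx: (x \in c) => //=.
  by rewrite (subsetP cJ') // inE.
apply: linear_cat => //; first by apply: linear_sub (typeA_path_chain path_c) => m /eqP->.
move=> x y; rewrite Ccomp LE Ccomp => sx /andP[nsy J'y].
apply: order2; [exact: subsetP sJ'J x (clJ' s x J's sx) | exact: subsetP sJ'J y J'y |].
by apply: contra nsy; apply: connect_trans sx.
Qed.

End TypeA.

(** * Generic degrees *)

Local Close Scope group_scope.
Local Open Scope ring_scope.

Section Idempotent.
Variable (K : fieldType).

(** For the rank factorization E = C R, idempotence gives R C = 1, and C R and R C have the same
    trace. *)
Lemma mxtrace_idempotent n (E : 'M[K]_n) : E *m E = E -> \tr E = (\rank E)%:R.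
Proof.
move=> EE; suff RC : row_base E *m col_base E = 1%:M.
  by rewrite -{1}(mulmx_base E) mxtrace_mulC RC mxtrace1.
apply: (row_free_inj (row_base_free E)); apply: (row_full_inj (col_base_full E)).
by rewrite mul1mx -[row_base E *m _ *m _]mulmxA mulmxA mulmx_base EE.
Qed.

Lemma mxtrace_scaled_idempotent n (e : 'M[K]_n) (p : K) : p != 0 -> e *m e = p *: e ->
  exists r : nat, \tr e = p * r%:R.
Proof.
move=> p0 ee; exists (\rank (p^-1 *: e)); rewrite -mxtrace_idempotent.
  by rewrite linearZ /= mulVKf.
by rewrite -scalemxAl -scalemxAr ee [p^-1 *: (p *: e)]scalerA mulVf // scale1r.
Qed.

End Idempotent.

Section HeckeIndex.
Variables (gT : finGroupType) (S : {set gT}).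
Hypothesis HS : coxeter_system S.
Variables (K : fieldType) (q : K) (n : nat) (rho : gT -> 'M[K]_n).
Local Notation l := (clen S).
Hypothesis rho1 : rho 1%g = 1%:M.
Hypothesis rho_sq : forall s, s \in S -> rho s *m rho s = q *: rho 1%g + (q - 1) *: rho s.
Hypothesis rhoM : forall x y, (l x + l y)%N = l (x * y)%g -> rho x *m rho y = rho (x * y)%g.
Variable I : {set gT}.
Hypothesis sIS : I \subset S.

Let e := \sum_(w in <<I>>%g) rho w.

(** Pair w with s w when the latter is longer: by the quadratic relation T_s (T_w + T_sw) = q (T_w +
    T_sw). *)
Lemma rho_gen_sum s : s \in I -> rho s *m e = q *: e.
Proof.
move=> Is; have Ss := subsetP sIS s Is; have WIs : s \in <<I>>%g by apply: mem_gen.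
have s2 := cox_invol HS Ss.
pose up w := l (s * w)%g == (l w).+1.
have upS w : up (s * w)%g = ~~ up w.
  rewrite /up mulgA s2 mul1g; have := clenM HS w Ss.
  by move: (l w) (l (s * w)%g) => a b; lia.
have rho_up w : up w -> rho s *m rho w = rho (s * w)%g.
  by move/eqP=> E; rewrite rhoM // clen_gen // E.
have eE : e = \sum_(w in <<I>>%g | up w) (rho w + rho (s * w)%g).
  rewrite /e (bigID up) big_split /=; congr (_ + _).
  rewrite (reindex_inj (mulgI s)) /=; apply: eq_bigl => w.
  by rewrite groupMl // upS negbK.
rewrite eE mulmx_sumr scaler_sumr; apply: eq_bigr => w /andP[_ up_w].
rewrite mulmxDr -(rho_up w up_w) mulmxA rho_sq // rho1 mulmxDl -!scalemxAl mul1mx.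
by rewrite addrCA -{1}[rho s *m rho w]scale1r -scalerDl addrCA subrr addr0 scalerDr.
Qed.

Lemma rho_sum w : w \in <<I>>%g -> rho w *m e = q ^+ l w *: e.
Proof.
move=> /(parabolic_word HS sIS)[u [Iu sz_u] Eu]; rewrite -Eu in sz_u *.
elim: u Iu sz_u {w Eu} => [|s u IHu] /=.
  by rewrite big_nil rho1 mul1mx clen1 // expr0 scale1r.
case/andP=> Is Iu; rewrite big_cons => sz; have Ss := subsetP sIS s Is.
have Su : all (mem S) u by apply/allP=> x /(allP Iu)/(subsetP sIS).
have sz_u : size u = l (gprod u).
  by apply/eqP; rewrite eqn_leq clen_le // andbT -ltnS sz clenM_le.
rewrite -rhoM; last by rewrite clen_gen // -sz -sz_u.
by rewrite -mulmxA IHu // -scalemxAr rho_gen_sum // scalerA -sz -sz_u exprSr.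
Qed.

Lemma trace_sum : poincare_on S q <<I>>%g != 0 ->
  exists r : nat, \sum_(w in <<I>>%g) \tr (rho w) = poincare_on S q <<I>>%g * r%:R.
Proof.
move=> p0; have ee : e *m e = poincare_on S q <<I>>%g *: e.
  by rewrite {1}/e mulmx_suml scaler_suml; apply: eq_bigr => w Ww; rewrite rho_sum.
by have [r trE] := mxtrace_scaled_idempotent p0 ee; exists r; rewrite -trE raddf_sum.
Qed.

End HeckeIndex.

(** * Class functions determined by their parabolic sums *)

Section Comparison.
Variables (gT : finGroupType) (S : {set gT}).
Hypothesis HS : coxeter_system S.
Variables (K : fieldType) (q : K).
Hypothesis char0 : forall n, n.+1%:R != 0 :> K.
Hypothesis q_neq1 : forall j, 1 - q ^+ j.+1 != 0.

Lemma eq_of_parabolic_sums (F g : gT -> K) (P : K) :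
  (forall x y, F (x ^ y)%g = F x) ->
  (forall c, all (mem S) c -> chain c -> F (gprod c) = qpower_sum q (size c).+1) ->
  (forall (I I' : {set gT}) x y, I \subset S -> I' \subset S ->
    (forall s t, s \in I -> t \in I' -> #[(s * t)%g]%g = 2%N) ->
    x \in <<I>>%g -> y \in <<I'>>%g -> F (x * y)%g = F x * F y) ->
  (forall x y, g (x ^ y)%g = g x) ->
  (forall I : {set gT}, I \subset S -> poincare_on S q <<I>>%g != 0) ->
  (forall I : {set gT}, I \subset S ->
    (\sum_(w in <<I>>%g) g w) * poincare_on S q <<I>>%g = #|<<I>>%g|%:R * P) ->
  forall L, all (mem S) L -> linear23 L -> forall w, w \in par L -> g w = P * F w.
Proof.
move=> FJ Fchain FM gJ p0 gsum L SL lin_L w Lw; apply/eqP; rewrite -subr_eq0; apply/eqP.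
apply: (class_function_vanish HS (f := fun w => g w - P * F w) char0 SL lin_L _ _ Lw).
  by move=> x y; rewrite gJ FJ.
(* Listing I in the order of L makes it a sublist, hence linear. *)
move=> I sIL; pose M := [seq x <- L | x \in I].
have EM : I = [set x in M].
  apply/setP=> x; rewrite inE mem_filter; apply/idP/andP=> [Ix | []//]; split=> //.
  by have := subsetP sIL x Ix; rewrite inE.
have sM : subseq M L := filter_subseq _ _.
have SM : all (mem S) M by apply/allP=> x /(mem_subseq sM)/(allP SL).
have sIS : I \subset S by rewrite EM; apply/subsetP=> x; rewrite inE => /(allP SM).
apply: (mulIf (p0 I sIS)); rewrite mul0r sumrB mulrBl gsum // -mulr_sumr -mulrA EM.
rewrite (molien_linear HS char0 q_neq1 FJ Fchain FM SM (subseq_linear23 sM lin_L)).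
by rewrite mulrC subrr.
Qed.

End Comparison.

Lemma Fq_char0 n : n.+1%:R != 0 :> Fq.
Proof.
rewrite -(rmorph_nat tofracC) tofrac_eq0 -polyC_natr polyC_eq0 pnatr_eq0 //.
Qed.

(** * Specialization at q = 1 and the sums of generic degrees *)

Section GenericDegrees.
Variables (gT : finGroupType) (S : {set gT}).
Hypothesis HS : coxeter_system S.

(** The Poincaré polynomial of the subgroup in the variable u = sqrt q, a polynomial so that it can
    be evaluated at u = 1. *)
Let poincare_onP (I : {set gT}) : {poly algC} := \sum_(w in <<I>>%g) 'X ^+ (2 * clen S w).

Let poincare_onE I : poincare_on S qq <<I>>%g = tofracC (poincare_onP I).
Proof.
rewrite /poincare_on /poincare_onP rmorph_sum; apply: eq_bigr => w _.
by rewrite rmorphXn /= exprM.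
Qed.

Let poincare_onP1 I : (poincare_onP I).[1] = #|<<I>>%g|%:R.
Proof.
rewrite /poincare_onP horner_sum -sum1_card natr_sum; apply: eq_bigr => w _.
by rewrite hornerXn expr1n.
Qed.

Lemma poincare_on_neq0 (I : {set gT}) : poincare_on S qq <<I>>%g != 0.
Proof.
rewrite poincare_onE tofrac_eq0; apply: contraTneq (cardG_gt0 <<I>>%G) => p0.
by have := poincare_onP1 I; rewrite p0 horner0 => /esym/eqP; rewrite pnatr_eq0 => /eqP ->.
Qed.

Variables (n : Iirr [set: gT] -> nat).
Variable (rho : forall i : Iirr [set: gT], gT -> 'M[Fq]_(n i)).
Hypothesis Hrep : forall i, hecke_rep S (rho i).
Hypothesis Hspec : forall i (w : gT), exists p : {poly algC},
  \tr (rho i w) = tofracC p /\ p.[1] = 'chi_i w.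

(* r is the rank of the idempotent e_I / P_I in rho i, an integer and therefore
   unchanged by the specialization q = 1. *)
Lemma index_multiplicity i (I : {set gT}) : I \subset S -> exists r : nat,
  \sum_(w in <<I>>%g) \tr (rho i w) = poincare_on S qq <<I>>%g * r%:R /\
  \sum_(w in <<I>>%g) cst ('chi_i w) = #|<<I>>%g|%:R * r%:R.
Proof.
move=> sIS; have [rho1 rho_sq rhoM] := Hrep i.
have [r trE] := trace_sum HS rho1 rho_sq rhoM sIS (poincare_on_neq0 I); exists r; split=> //.
have [p pP] : exists p : gT -> {poly algC}, forall w, \tr (rho i w) = tofracC (p w) /\ (p w).[1] = 'chi_i w.
  by apply: (fin_all_exists (P := fun w p => \tr (rho i w) = tofracC p /\ p.[1] = 'chi_i w)).
(* Polynomials embed in the fraction field, so the trace identity holds between polynomials and can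
   be evaluated at u = 1. *)
have Ep : \sum_(w in <<I>>%g) p w = poincare_onP I * r%:R.
  apply/eqP; rewrite -tofrac_eq rmorph_sum rmorphM rmorph_nat /= -poincare_onE -trE.
  by apply/eqP; apply: eq_bigr => w _; case: (pP w) => ->.
have /(congr1 (horner^~ 1)) := Ep; rewrite horner_sum hornerM poincare_onP1 -polyC_natr hornerC => E1.
rewrite -rmorph_sum -!(rmorph_nat cst) -rmorphM /= -E1; congr cst.
by apply: eq_bigr => w _; case: (pP w).
Qed.

Variable (d : Iirr [set: gT] -> Fq).
Hypothesis Hd : forall w : gT, \sum_i \tr (rho i w) * d i =
  (if w == 1%g then poincare S qq else 0).

Lemma generic_degree_sum (I : {set gT}) : I \subset S ->
  (\sum_(w in <<I>>%g) \sum_i cst ('chi_i w) * d i) * poincare_on S qq <<I>>%g =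
    #|<<I>>%g|%:R * poincare S qq.
Proof.
move=> sIS; have [r rP] := fin_all_exists (fun i => index_multiplicity i sIS).
rewrite exchange_big /=.
rewrite (eq_bigr (fun i => #|<<I>>%g|%:R * ((r i)%:R * d i))) => [|i _]; last first.
  by rewrite -mulr_suml (rP i).2 mulrA.
rewrite -mulr_sumr -mulrA; congr (_ * _); rewrite mulrC mulr_sumr.
transitivity (\sum_(w in <<I>>%g) \sum_i \tr (rho i w) * d i).
  rewrite exchange_big /=; apply: eq_bigr => i _.
  by rewrite -mulr_suml (rP i).1 mulrA.
rewrite (bigD1 1%g) //= Hd eqxx big1 ?addr0 // => w /andP[_ /negPf w1].
by rewrite Hd w1.
Qed.

End GenericDegrees.

Theorem theorem1p1 (gT : finGroupType) (S : {set gT})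
  (HS : coxeter_system S)
  (n : Iirr [set: gT] -> nat)
  (rho : forall i : Iirr [set: gT], gT -> 'M[Fq]_(n i))
  (Hrep : forall i, hecke_rep S (rho i))
  (Hirr : forall i, hecke_irr (rho i))
  (Hspec : forall i (w : gT), exists p : {poly algC},
       \tr (rho i w) = tofracC p /\ p.[1] = 'chi_i w)
  (d : Iirr [set: gT] -> Fq)
  (Hd : forall w : gT, \sum_i \tr (rho i w) * d i =
                        (if w == 1%g then poincare S qq else 0))
  (J : {set gT}) (HJS : J \subset S) (HJ : all_components_typeA J)
  (w : gT) (Hw : exists x : gT, (w ^ x)%g \in <<J>>%g) :
  \sum_i cst ('chi_i w) * d i =
    (1 - qq) ^+ #|S| * poincare S qq /
      \det (1%:M - qq *: map_mx cst (geom_rep S w)).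
Proof.
have [L [lin_L EL]] := typeA_linear HS HJS HJ.
have SL : all (mem S) L.
  by apply/allP=> x Lx; apply: (subsetP HJS); rewrite -EL inE.
case: Hw => x Jwx; rewrite -EL in Jwx.
pose g w := \sum_i cst ('chi_i w) * d i.
have gJ y z : g (y ^ z)%g = g y.
  by apply: eq_bigr => i _; rewrite cfunJ ?inE.
have := @eq_of_parabolic_sums _ _ HS _ qq Fq_char0 qq_neq1 (invdet S) g (poincare S qq)
  (invdet_conj HS) (invdet_chain HS) (@invdetM _ _ HS) gJ (fun I _ => poincare_on_neq0 S I)
  (generic_degree_sum HS Hrep Hspec Hd) L SL lin_L _ Jwx.
rewrite gJ (invdet_conj HS) => Eg; rewrite -[LHS]/(g w) Eg /invdet mulrCA mulrA.
by [].
Qed.
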